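(* Let $p$ be a prime and let $X$ be a compact metrizable space equipped with a continuous action of the $p$-adic group $\mathbb{Z}_p$. Let $\delta$ denote the induced action of $\mathbb{Z}_p$ on $C(X)$ (equivalently, the induced $C(\mathbb{Z}_p)$-coaction on $C(X)$). If $\dim_{\rm Rok}(\delta)<\infty$, then $\dim_{\rm Rok}(\delta)\leq 3$.
   Context: $\mathbb{Z}_p=\varprojlim \mathbb{Z}/p^i\mathbb{Z}$ is the compact group of $p$-adic integers. Sequence algebras: for a separable unital C*-algebra $A$, $A_\infty:=\ell^\infty(\mathbb{N},A)/c_0(\mathbb{N},A)$, and $A_\infty\cap A'$ is the commutant in $A_\infty$ of the copy of $A$ given by constant sequences. An action of a group on $A$ induces componentwise actions on $A_\infty$ and $A_\infty\cap A'$. A completely positive contractive map $\varphi\colon A\to B$ between C*-algebras is order zero if $\varphi(a)\varphi(b)=0$ whenever $ab=0$. Rokhlin dimension: for an action $\delta\colon G\to{\rm Aut}(A)$ of a compact metrizable group $G$ on a separable unital C*-algebra $A$, $\dim_{\rm Rok}(\delta)$ is the minimal integer $n\ge0$ such that there exist $G$-equivariant completely positive contractive order zero maps $\varphi_0,\ldots,\varphi_n\colon C(G)\to A_\infty\cap A'$ with $\sum_{i=0}^n\varphi_i(1)=1$ (where $G$ acts on $C(G)$ by translation), and $\infty$ if no such $n$ exists. *)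

(* Defs.v *)
From HB Require Import structures.
From mathcomp Require Import all_boot all_order all_algebra complex.
From mathcomp Require Import all_classical all_reals all_analysis.
From mathcomp Require Import ring lra.

Set Implicit Arguments.
Unset Strict Implicit.
Unset Printing Implicit Defensive.

Import Order.TTheory GRing.Theory Num.Theory numFieldNormedType.Exports.
Import Normc.

Local Open Scope classical_set_scope.
Local Open Scope quotient_scope.
Local Open Scope complex_scope.
Local Open Scope ring_scope.

HB.instance Definition _ (R : realType) := NormedModule.copy R[i] R[i]^o.

(* Scalars are a field of the mixin, rather than an lmodType structure, so that
   the zero algebra (the case of C(X) with X empty) is allowed: algType excludes
   it, and HB has no join of pzRingType and lmodType. *)
HB.mixin Record isCStarAlgebra (R : realType) A & GRing.PzRing A := {
  cscale : R[i] -> A -> A;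
  cscaleA : forall a b x, cscale a (cscale b x) = cscale (a * b) x;
  cscale1 : forall x, cscale 1 x = x;
  cscaleDr : forall a x y, cscale a (x + y) = cscale a x + cscale a y;
  cscaleDl : forall a b x, cscale (a + b) x = cscale a x + cscale b x;
  cscaleAl : forall a x y, cscale a (x * y) = cscale a x * y;
  cscaleAr : forall a x y, cscale a (x * y) = x * cscale a y;
  star : A -> A;
  starK : forall x, star (star x) = x;
  starD : forall x y, star (x + y) = star x + star y;
  starM : forall x y, star (x * y) = star y * star x;
  starZ : forall a x, star (cscale a x) = cscale a^* (star x);
  cnorm : A -> R;
  cnormD : forall x y, cnorm (x + y) <= cnorm x + cnorm y;
  cnormZ : forall a x, cnorm (cscale a x) = normc a * cnorm x;
  cnorm0_eq0 : forall x, cnorm x = 0 -> x = 0;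
  cnormM : forall x y, cnorm (x * y) <= cnorm x * cnorm y;
  cnorm_starM : forall x, cnorm (star x * x) = cnorm x ^+ 2;
  cnorm_complete : forall u : nat -> A,
    (forall e, 0 < e -> exists N, forall m n,
       (N <= m)%N -> (N <= n)%N -> cnorm (u m - u n) < e) ->
    exists l, cnorm (u n - l) @[n --> \oo] --> (0 : R)
}.

#[short(type="cstarAlgType")]
HB.structure Definition CStarAlgebra (R : realType) :=
  {A of GRing.PzRing A & isCStarAlgebra R A}.

Section CStarTheory.
Variables (R : realType) (A : cstarAlgType R).
Implicit Types x y : A.

Lemma cscale0 x : cscale 0 x = 0.
Proof.
have h := cscaleDl 0 0 x; rewrite addr0 in h.
by apply: (@addrI _ (cscale 0 x)); rewrite -h addr0.
Qed.

Lemma cscaleN1 x : cscale (-1) x = - x.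
Proof.
apply: (@addrI _ x); rewrite subrr -{1}(cscale1 x) -cscaleDl subrr.
exact: cscale0.
Qed.

Lemma cnorm0 : cnorm (0 : A) = 0.
Proof. by rewrite -(cscale0 0) cnormZ normc0 mul0r. Qed.

Lemma cnormN x : cnorm (- x) = cnorm x.
Proof.
rewrite -cscaleN1 cnormZ -[RHS]mul1r; congr (_ * _).
by rewrite /normc /= oppr0 sqrrN expr0n addr0 expr1n sqrtr1.
Qed.

Lemma cnorm_ge0 x : 0 <= cnorm x.
Proof.
rewrite -(@pmulrn_lge0 _ _ 2)// mulr2n -{2}(cnormN x).
by rewrite (le_trans _ (cnormD _ _))// subrr cnorm0.
Qed.

Lemma cnormB x y : cnorm (x - y) = cnorm (y - x).
Proof. by rewrite -cnormN opprB. Qed.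

Lemma cnorm_star x : cnorm (star x) = cnorm x.
Proof.
have h (z : A) : cnorm z <= cnorm (star z).
  have [->|z0] := eqVneq (cnorm z) 0; first exact: cnorm_ge0.
  have zp : 0 < cnorm z by rewrite lt0r z0 cnorm_ge0.
  by rewrite -(ler_pM2r zp) -expr2 -cnorm_starM cnormM.
by apply/eqP; rewrite eq_le h andbT -{2}(starK x) h.
Qed.

Lemma star0 : star (0 : A) = 0.
Proof. by apply: (@addrI _ (star 0)); rewrite -starD !addr0. Qed.

Lemma starN x : star (- x) = - star x.
Proof. by apply: (@addrI _ (star x)); rewrite -starD !subrr star0. Qed.

Lemma star1 : star (1 : A) = 1.
Proof. by rewrite -[LHS]mulr1 -{2}(starK 1) -starM mulr1 starK. Qed.

Lemma cnorm_dist x y z : cnorm (x - z) <= cnorm (x - y) + cnorm (y - z).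
Proof. by rewrite (le_trans _ (cnormD _ _))// addrA subrK. Qed.

End CStarTheory.

Section SupInf.
Variable R : realType.

Definition supf (T : Type) (f : T -> R) : R := sup (range f).

Lemma supf_ub T (f : T -> R) M x : (forall y, f y <= M) -> f x <= supf f.
Proof. by move=> fM; apply: ub_le_sup; [exists M => _ [y _ <-]|exists x]. Qed.

Lemma supf_le T (f : T -> R) M : 0 <= M -> (forall y, f y <= M) -> supf f <= M.
Proof.
move=> M0 fM; have [[y]|r0] := pselect (range f !=set0).
  by move=> yf; apply: ge_sup; [exists y|move=> _ [z _ <-]].
by rewrite /supf (_ : range f = set0) ?sup0//; apply/eqP/negPn/negP => /set0P.
Qed.

Lemma supf_ge0 T (f : T -> R) M :
  (forall y, 0 <= f y) -> (forall y, f y <= M) -> 0 <= supf f.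
Proof.
move=> f0 fM; have [[_ [x _ _]]|r0] := pselect (range f !=set0).
  exact: le_trans (f0 x) (supf_ub x fM).
by rewrite /supf (_ : range f = set0) ?sup0//; apply/eqP/negPn/negP => /set0P.
Qed.

Lemma le_of_lt (x y : R) : (forall t, y < t -> x <= t) -> x <= y.
Proof. by move=> h; apply/ler_addgt0Pr => e e0; apply: h; rewrite ltrDl. Qed.

Lemma le_mul_of_lt (x y z : R) : 0 <= y -> 0 <= z ->
  (forall s t, y < s -> z < t -> x <= s * t) -> x <= y * z.
Proof.
move=> y0 z0 h; apply/ler_addgt0Pr => e e0.
pose d := Num.min 1 (e / (y + z + 1)).
have yz : 0 < y + z + 1 by rewrite ltr_wpDl// addr_ge0.
have d0 : 0 < d by rewrite lt_min ltr01 divr_gt0.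
have := h (y + d) (z + d); rewrite !ltrDl => /(_ d0 d0)/le_trans; apply.
rewrite mulrDl !mulrDr -addrA lerD2l.
have -> : y * d + (d * z + d * d) = d * (y + z + d).
  by rewrite !mulrDr addrA [y * d]mulrC.
apply: (@le_trans _ _ (d * (y + z + 1))).
  by rewrite ler_pM2l// lerD2l ge_min lexx.
by rewrite -ler_pdivlMr// ge_min lexx orbT.
Qed.

Lemma cvg0P (u : nat -> R) : (forall n, 0 <= u n) ->
  (u n @[n --> \oo] --> (0 : R)) <->
  (forall e, 0 < e -> exists N, forall n, (N <= n)%N -> u n < e).
Proof.
move=> u0; split.
  move=> /cvgrPdist_lt h e /h[N _ hN]; exists N => n /hN/=.
  by rewrite sub0r normrN ger0_norm.
move=> h; apply/cvgrPdist_lt => e /h[N hN]; exists N => // n /hN/=.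
by rewrite sub0r normrN ger0_norm.
Qed.

Lemma exists_half_lt (e : R) : 0 < e -> exists k, 2^-1 ^+ k < e.
Proof.
move=> e0; have h : (2^-1 : R) ^+ n @[n --> \oo] --> (0 : R).
  by apply: cvg_expr; rewrite ger0_norm ?invr_ge0// invf_lt1 ?ltr1n.
have [|N hN] := (cvg0P _).1 h e e0; first by move=> n; rewrite exprn_ge0 ?invr_ge0.
by exists N; apply: hN.
Qed.

End SupInf.

Section Complex.
Variable R : realType.
Implicit Types z w : R[i].

Lemma normcE_norm z : `|z| = (normc z)%:C. Proof. by []. Qed.

Lemma normc_ge0 z : 0 <= normc z.
Proof. by rewrite -ler0c -normcE_norm normr_ge0. Qed.

Lemma normc_conj z : normc z^* = normc z.
Proof. by case: z => a b /=; rewrite sqrrN. Qed.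

Lemma normc_conjM z : normc (z^* * z) = normc z ^+ 2.
Proof. by rewrite normcM normc_conj expr2. Qed.

Lemma Re_le_normc z : `|complex.Re z| <= normc z.
Proof.
case: z => a b /=; rewrite -sqrtr_sqr ler_sqrt ?addr_ge0 ?sqr_ge0//.
by rewrite lerDl sqr_ge0.
Qed.

Lemma Im_le_normc z : `|complex.Im z| <= normc z.
Proof.
case: z => a b /=; rewrite -sqrtr_sqr ler_sqrt ?addr_ge0 ?sqr_ge0//.
by rewrite lerDr sqr_ge0.
Qed.

Lemma normc_le_ReIm z : normc z <= `|complex.Re z| + `|complex.Im z|.
Proof.
case: z => a b /=; rewrite -[leRHS]ger0_norm ?addr_ge0// -sqrtr_sqr.
rewrite ler_sqrt ?sqr_ge0// sqrrD !real_normK ?num_real//.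
by rewrite -addrA [_ *+ 2 + _]addrC addrA lerDl mulrn_wge0// mulr_ge0.
Qed.

Lemma cvgcP (T : Type) (F : set_system T) (FF : Filter F) (f : T -> R[i])
    (l : R[i]) :
  (f x @[x --> F] --> l) <->
  (forall e : R, 0 < e -> \forall x \near F, normc (l - f x) < e).
Proof.
split.
  move=> /cvgrPdist_lt h e e0; have := h e%:C; rewrite ltcR => /(_ e0).
  by apply: filterS => x; rewrite normcE_norm ltcR.
move=> h; apply/cvgrPdist_lt => e e0.
have eE : (complex.Re e)%:C = e by rewrite RRe_real// gtr0_real.
have := h (complex.Re e); rewrite -ltcR eE => /(_ e0).
by apply: filterS => x; rewrite normcE_norm -{2}eE ltcR.
Qed.

Lemma real_cauchy (u : nat -> R) :
  (forall e, 0 < e -> exists N, forall m n,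
     (N <= m)%N -> (N <= n)%N -> `|u m - u n| < e) ->
  exists l : R, u n @[n --> \oo] --> l.
Proof.
move=> h; apply/cvg_ex; apply: (@cauchy_cvg R (u @ \oo)).
apply: cauchy_exP => e e0; have [N hN] := h e e0.
by exists (u N), N => // n /= Nn; apply: hN.
Qed.

Lemma normc_cauchy (u : nat -> R[i]) :
  (forall e, 0 < e -> exists N, forall m n,
     (N <= m)%N -> (N <= n)%N -> normc (u m - u n) < e) ->
  exists l, forall e, 0 < e -> exists N, forall n, (N <= n)%N -> normc (l - u n) < e.
Proof.
move=> h.
have [a /cvgrPdist_lt ha] : exists l : R, complex.Re (u n) @[n --> \oo] --> l.
  apply: real_cauchy => e /h[N hN]; exists N => m n Nm Nn.
  by rewrite (le_lt_trans _ (hN m n Nm Nn))// -raddfB Re_le_normc.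
have [b /cvgrPdist_lt hb] : exists l : R, complex.Im (u n) @[n --> \oo] --> l.
  apply: real_cauchy => e /h[N hN]; exists N => m n Nm Nn.
  by rewrite (le_lt_trans _ (hN m n Nm Nn))// -raddfB Im_le_normc.
exists (a +i* b) => e e0.
have e2 : 0 < e / 2 by rewrite divr_gt0.
have [N _ hN] := ha _ e2; have [M _ hM] := hb _ e2.
exists (maxn N M) => n; rewrite geq_max => /andP[Nn Mn].
rewrite (le_lt_trans (normc_le_ReIm _))// [ltRHS]splitr ltrD//.
  by have := hN n Nn; rewrite /=; case: (u n).
by have := hM n Mn; rewrite /=; case: (u n).
Qed.

End Complex.

HB.mixin Record isCompactSpace T & Topological T := {
  compactT : compact [set: T]
}.

#[short(type="compactType")]
HB.structure Definition CompactSpace := {T of Topological T & isCompactSpace T}.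

#[short(type="compactMetricType")]
HB.structure Definition CompactMetric (R : realType) :=
  {T of Metric R T & isCompactSpace T}.

#[short(type="compactZmodType")]
HB.structure Definition CompactZmodule :=
  {T of TopologicalZmodule T & isCompactSpace T}.

Definition Cfun (R : realType) (X : topologicalType) : Type :=
  continuousType X R[i].

Section CfunAlgebra.
Variables (R : realType) (X : topologicalType).
Implicit Types f g h : Cfun R X.

HB.instance Definition _ := Choice.on (Cfun R X).

Definition Cfun_fun f : X -> R[i] := Continuous.sort f.
Coercion Cfun_fun : Cfun >-> Funclass.

Lemma CfunP f g : (forall x, f x = g x) -> f = g.
Proof. by move=> fg; apply/continuousEP. Qed.

Lemma Cfun_continuous f : continuous f. Proof. exact: cts_fun. Qed.

Definition mkCfun (f : X -> R[i]) (cf : continuous f) : Cfun R X :=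
  (mkcts cf : continuousType X R[i]).

Lemma continuous_normcP (f : X -> R[i]) : continuous f <->
  (forall x (e : R), 0 < e -> \forall y \near x, normc (f x - f y) < e).
Proof. by split=> cf x; [exact: (cvgcP _ _ _).1 (cf x)|exact: (cvgcP _ _ _).2 (cf x)]. Qed.

Fact cst_cts (c : R[i]) : continuous (fun _ : X => c).
Proof. by move=> x; exact: cvg_cst. Qed.

Fact add_cts f g : continuous (fun x => f x + g x).
Proof. by move=> x; apply: cvgD; exact: Cfun_continuous. Qed.

Fact opp_cts f : continuous (fun x => - f x).
Proof. by move=> x; apply: cvgN; exact: Cfun_continuous. Qed.

Fact mul_cts f g : continuous (fun x => f x * g x).
Proof. by move=> x; apply: cvgM; exact: Cfun_continuous. Qed.

Fact conj_cts f : continuous (fun x => (f x)^*).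
Proof.
apply/continuous_normcP => x e e0.
have /continuous_normcP/(_ x e e0) := Cfun_continuous (f := f).
by apply: filterS => y; rewrite -rmorphB/= normc_conj.
Qed.

Definition Cfun_add f g := mkCfun (@add_cts f g).
Definition Cfun_opp f := mkCfun (@opp_cts f).
Definition Cfun_mul f g := mkCfun (@mul_cts f g).

Fact Cfun_addA : associative Cfun_add.
Proof. by move=> f g h; apply: CfunP => x; exact: addrA. Qed.
Fact Cfun_addC : commutative Cfun_add.
Proof. by move=> f g; apply: CfunP => x; exact: addrC. Qed.
Fact Cfun_add0 : left_id (mkCfun (@cst_cts 0)) Cfun_add.
Proof. by move=> f; apply: CfunP => x; exact: add0r. Qed.
Fact Cfun_addN : left_inverse (mkCfun (@cst_cts 0)) Cfun_opp Cfun_add.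
Proof. by move=> f; apply: CfunP => x; exact: addNr. Qed.
HB.instance Definition _ :=
  GRing.isZmodule.Build (Cfun R X) Cfun_addA Cfun_addC Cfun_add0 Cfun_addN.

Fact Cfun_mulA : associative Cfun_mul.
Proof. by move=> f g h; apply: CfunP => x; exact: mulrA. Qed.
Fact Cfun_mul1 : left_id (mkCfun (@cst_cts 1)) Cfun_mul.
Proof. by move=> f; apply: CfunP => x; exact: mul1r. Qed.
Fact Cfun_mulr1 : right_id (mkCfun (@cst_cts 1)) Cfun_mul.
Proof. by move=> f; apply: CfunP => x; exact: mulr1. Qed.
Fact Cfun_mulDl : left_distributive Cfun_mul +%R.
Proof. by move=> f g h; apply: CfunP => x; exact: mulrDl. Qed.
Fact Cfun_mulDr : right_distributive Cfun_mul +%R.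
Proof. by move=> f g h; apply: CfunP => x; exact: mulrDr. Qed.
HB.instance Definition _ := GRing.Zmodule_isPzRing.Build (Cfun R X)
  Cfun_mulA Cfun_mul1 Cfun_mulr1 Cfun_mulDl Cfun_mulDr.

Lemma CfunD f g x : (f + g) x = f x + g x. Proof. by []. Qed.
Lemma CfunN f x : (- f) x = - f x. Proof. by []. Qed.
Lemma CfunB f g x : (f - g) x = f x - g x. Proof. by []. Qed.
Lemma CfunM f g x : (f * g) x = f x * g x. Proof. by []. Qed.
Lemma Cfun0 x : (0 : Cfun R X) x = 0. Proof. by []. Qed.
Lemma Cfun1 x : (1 : Cfun R X) x = 1. Proof. by []. Qed.

Definition Cfun_scale (a : R[i]) f : Cfun R X := mkCfun (@cst_cts a) * f.
Definition Cfun_star f : Cfun R X := mkCfun (@conj_cts f).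
Definition Cfun_norm f : R := supf (fun x => normc (f x)).

End CfunAlgebra.

Section CfunCStar.
Variables (R : realType) (X : compactType).
Implicit Types f g h : Cfun R X.

Lemma Cfun_bounded f : exists M, forall x, normc (f x) <= M.
Proof.
have cf : {within [set: X], continuous (fun x => normc (f x))}.
  apply: continuous_subspaceT => x; apply/cvgrPdist_lt => e e0.
  have /continuous_normcP/(_ x e e0) := Cfun_continuous (f := f).
  apply: filterS => y; apply: le_lt_trans.
  have h z w : normc z - normc w <= normc (z - w) :> R.
    by rewrite lerBlDr (le_trans _ (le_normcD _ _))// subrK.
  rewrite ler_norml h andbT.
  by have := h (f y) (f x); rewrite -[normc (f y - _)]normcN opprB -lerN2 opprB.
have /compact_bounded[M [_ hM]] := continuous_compact cf (@compactT X).
exists (M + 1) => x; have := hM (M + 1); rewrite ltrDl => /(_ ltr01 (normc (f x))).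
by rewrite /= ger0_norm ?normc_ge0//; apply; exists x.
Qed.

Lemma Cfun_norm_ub f x : normc (f x) <= Cfun_norm f.
Proof. by have [M fM] := Cfun_bounded f; apply: (supf_ub x fM). Qed.

Lemma Cfun_norm_le f M :
  0 <= M -> (forall x, normc (f x) <= M) -> Cfun_norm f <= M.
Proof. exact: supf_le. Qed.

Lemma Cfun_norm_ge0 f : 0 <= Cfun_norm f.
Proof.
have [M fM] := Cfun_bounded f.
by apply: supf_ge0 fM => x; exact: normc_ge0.
Qed.

Fact Cfun_scaleA a b f :
  Cfun_scale a (Cfun_scale b f) = Cfun_scale (a * b) f.
Proof. by apply: CfunP => x; exact: mulrA. Qed.

Fact Cfun_scale1 f : Cfun_scale 1 f = f.
Proof. by apply: CfunP => x; exact: mul1r. Qed.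

Fact Cfun_scaleDr a f g :
  Cfun_scale a (f + g) = Cfun_scale a f + Cfun_scale a g.
Proof. exact: mulrDr. Qed.

Fact Cfun_scaleDl a b f :
  Cfun_scale (a + b) f = Cfun_scale a f + Cfun_scale b f.
Proof. by apply: CfunP => x; exact: mulrDl. Qed.

Fact Cfun_scaleAl a f g : Cfun_scale a (f * g) = Cfun_scale a f * g.
Proof. exact: mulrA. Qed.

Fact Cfun_scaleAr a f g : Cfun_scale a (f * g) = f * Cfun_scale a g.
Proof. by apply: CfunP => x; exact: mulrCA. Qed.

Fact Cfun_starK f : Cfun_star (Cfun_star f) = f.
Proof. by apply: CfunP => x; exact: conjcK. Qed.

Fact Cfun_starD f g : Cfun_star (f + g) = Cfun_star f + Cfun_star g.
Proof. by apply: CfunP => x; exact: rmorphD. Qed.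

Fact Cfun_starM f g : Cfun_star (f * g) = Cfun_star g * Cfun_star f.
Proof. by apply: CfunP => x; exact: etrans (rmorphM _ _ _) (mulrC _ _). Qed.

Fact Cfun_starZ a f : Cfun_star (Cfun_scale a f) = Cfun_scale a^* (Cfun_star f).
Proof. by apply: CfunP => x; exact: rmorphM. Qed.

Fact Cfun_normD f g : Cfun_norm (f + g) <= Cfun_norm f + Cfun_norm g.
Proof.
apply: Cfun_norm_le => [|x]; first by rewrite addr_ge0// Cfun_norm_ge0.
by rewrite (le_trans (le_normcD _ _))// lerD// Cfun_norm_ub.
Qed.

Fact Cfun_normM f g : Cfun_norm (f * g) <= Cfun_norm f * Cfun_norm g.
Proof.
apply: Cfun_norm_le => [|x]; first by rewrite mulr_ge0// Cfun_norm_ge0.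
by rewrite normcM ler_pM// ?normc_ge0 ?Cfun_norm_ub.
Qed.

Fact Cfun_normZ_le a f : Cfun_norm (Cfun_scale a f) <= normc a * Cfun_norm f.
Proof.
apply: Cfun_norm_le => [|x]; first by rewrite mulr_ge0// ?normc_ge0 ?Cfun_norm_ge0.
by rewrite normcM ler_wpM2l ?normc_ge0 ?Cfun_norm_ub.
Qed.

Fact Cfun_normZ a f : Cfun_norm (Cfun_scale a f) = normc a * Cfun_norm f.
Proof.
apply/eqP; rewrite eq_le Cfun_normZ_le/=.
have [->|a0] := eqVneq a 0; first by rewrite normc0 mul0r Cfun_norm_ge0.
have na : 0 < normc a.
  by rewrite lt0r normc_ge0 andbT; apply: contra a0 => /eqP/eq0_normc ->.
have := Cfun_normZ_le a^-1 (Cfun_scale a f).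
by rewrite Cfun_scaleA mulVf// Cfun_scale1 normcV -ler_pdivrMl ?invr_gt0// invrK.
Qed.

Fact Cfun_norm0_eq0 f : Cfun_norm f = 0 -> f = 0.
Proof.
move=> f0; apply: CfunP => x; apply: eq0_normc; apply/eqP.
by rewrite eq_le normc_ge0 andbT -f0 Cfun_norm_ub.
Qed.

Fact Cfun_norm_starM f : Cfun_norm (Cfun_star f * f) = Cfun_norm f ^+ 2.
Proof.
apply/eqP; rewrite eq_le; apply/andP; split.
  apply: Cfun_norm_le => [|x]; first by rewrite sqr_ge0.
  by rewrite normc_conjM lerXn2r// ?nnegrE ?normc_ge0 ?Cfun_norm_ge0 ?Cfun_norm_ub.
rewrite -ler_sqrt ?Cfun_norm_ge0// sqrtr_sqr ger0_norm ?Cfun_norm_ge0//.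
apply: Cfun_norm_le => [|x]; first exact: sqrtr_ge0.
rewrite -[leLHS]ger0_norm ?normc_ge0// -sqrtr_sqr ler_sqrt ?Cfun_norm_ge0//.
by rewrite -normc_conjM; exact: (Cfun_norm_ub (Cfun_star f * f)).
Qed.

Fact Cfun_complete (u : nat -> Cfun R X) :
  (forall e, 0 < e -> exists N, forall m n,
     (N <= m)%N -> (N <= n)%N -> Cfun_norm (u m - u n) < e) ->
  exists l, Cfun_norm (u n - l) @[n --> \oo] --> (0 : R).
Proof.
move=> h.
have /choice[l hl] x : exists l, forall e : R, 0 < e ->
    exists N, forall n, (N <= n)%N -> normc (l - u n x) < e.
  apply: normc_cauchy => e /h[N hN]; exists N => m n Nm Nn.
  by rewrite (le_lt_trans _ (hN m n Nm Nn))//; exact: (Cfun_norm_ub (u m - u n)).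
have unif e : 0 < e -> exists N, forall n x, (N <= n)%N -> normc (u n x - l x) <= e.
  move=> e0; have e2 : 0 < e / 2 by rewrite divr_gt0.
  have [N hN] := h _ e2; exists N => n x Nn.
  have [M hM] := hl x _ e2.
  rewrite -(subrK (u (maxn N M) x) (u n x)) -addrA (le_trans (le_normcD _ _))//.
  rewrite [leRHS]splitr lerD//.
    rewrite (le_trans (Cfun_norm_ub (u n - u (maxn N M)) x))// ltW// hN//.
    exact: leq_maxl.
  by rewrite -normcN opprB ltW// hM// leq_maxr.
have cl : continuous l.
  apply/continuous_normcP => x e e0; have e3 : 0 < e / 3 by rewrite divr_gt0.
  have [N hN] := unif _ e3.
  have /continuous_normcP/(_ x _ e3) := Cfun_continuous (f := u N).
  apply: filterS => y hy.
  have -> : l x - l y = (l x - u N x) + (u N x - u N y) + (u N y - l y).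
    by rewrite !addrA !subrK.
  have -> : e = e / 3 + e / 3 + e / 3 by field.
  rewrite (le_lt_trans (le_normcD _ _))// ltr_leD//; last exact: hN.
  rewrite (le_lt_trans (le_normcD _ _))// ler_ltD//.
  by rewrite -normcN opprB hN.
exists (mkCfun cl); apply/cvg0P => [n|e e0]; first exact: Cfun_norm_ge0.
have e2 : 0 < e / 2 by rewrite divr_gt0.
have [N hN] := unif _ e2; exists N => n Nn.
apply: (@le_lt_trans _ _ (e / 2)); last by rewrite ltr_pdivrMr// ltr_pMr// ltr1n.
by apply: Cfun_norm_le => [|x]; [exact: ltW|exact: hN].
Qed.

HB.instance Definition _ := isCStarAlgebra.Build R (Cfun R X)
  Cfun_scaleA Cfun_scale1 Cfun_scaleDr Cfun_scaleDl Cfun_scaleAl Cfun_scaleAr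
  Cfun_starK Cfun_starD Cfun_starM Cfun_starZ
  Cfun_normD Cfun_normZ Cfun_norm0_eq0 Cfun_normM Cfun_norm_starM Cfun_complete.

End CfunCStar.

Section BoundedSequences.
Variables (R : realType) (A : cstarAlgType R).

Definition bounded_seq : {pred nat -> A} :=
  fun u => `[< exists M : R, forall n, cnorm (u n) <= M >].

Record linf := Linf { linf_seq :> nat -> A; _ : linf_seq \in bounded_seq }.

HB.instance Definition _ := [isSub for linf_seq].
HB.instance Definition _ := [Choice of linf by <:].

Fact bounded_seq_subring : subring_closed bounded_seq.
Proof.
split=> [|u v /asboolP[M uM] /asboolP[N vN]|u v /asboolP[M uM] /asboolP[N vN]];
    apply/asboolP.
- by exists (cnorm (1 : A)).
- by exists (M + N) => n; rewrite (le_trans (cnormD _ _))// cnormN lerD.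
- by exists (M * N) => n; rewrite (le_trans (cnormM _ _))// ler_pM// cnorm_ge0.
Qed.

HB.instance Definition _ :=
  GRing.SubChoice_isSubPzRing.Build _ _ linf bounded_seq_subring.

Definition mklinf (u : nat -> A) (bu : exists M : R, forall n, cnorm (u n) <= M)
  : linf := Linf (asboolT bu).

Implicit Types u v : linf.

Lemma linfP u v : (forall n, u n = v n) -> u = v.
Proof. by move=> uv; apply/val_inj/funext. Qed.

Lemma linf_bounded u : exists M, forall n, cnorm (u n) <= M.
Proof. by case: u => u /= /asboolP. Qed.

Fact scale_bounded a u : exists M, forall n, cnorm (cscale a (u n)) <= M.
Proof.
have [M uM] := linf_bounded u; exists (normc a * M) => n.
by rewrite cnormZ ler_wpM2l ?normc_ge0.
Qed.

Fact star_bounded u : exists M, forall n, cnorm (star (u n)) <= M.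
Proof.
by have [M uM] := linf_bounded u; exists M => n; rewrite cnorm_star.
Qed.

Fact cst_bounded (a : A) : exists M, forall n : nat, cnorm a <= M.
Proof. by exists (cnorm a). Qed.

Definition linf_scale a u := mklinf (@scale_bounded a u).
Definition linf_star u := mklinf (@star_bounded u).
Definition linf_cst (a : A) := mklinf (cst_bounded a).
Definition linf_norm u : R := supf (fun n => cnorm (u n)).

Lemma linfD u v n : (u + v) n = u n + v n. Proof. by []. Qed.
Lemma linfN u n : (- u) n = - u n. Proof. by []. Qed.
Lemma linfB u v n : (u - v) n = u n - v n. Proof. by []. Qed.
Lemma linfM u v n : (u * v) n = u n * v n. Proof. by []. Qed.
Lemma linf0 n : (0 : linf) n = 0. Proof. by []. Qed.
Lemma linf1 n : (1 : linf) n = 1. Proof. by []. Qed.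

Lemma linf_norm_ub u n : cnorm (u n) <= linf_norm u.
Proof. by have [M uM] := linf_bounded u; exact: (supf_ub n uM). Qed.

Lemma linf_norm_le u M :
  0 <= M -> (forall n, cnorm (u n) <= M) -> linf_norm u <= M.
Proof. exact: supf_le. Qed.

Lemma linf_norm_ge0 u : 0 <= linf_norm u.
Proof. exact: le_trans (cnorm_ge0 _) (linf_norm_ub u 0). Qed.

Lemma linf_normD u v : linf_norm (u + v) <= linf_norm u + linf_norm v.
Proof.
apply: linf_norm_le => [|n]; first by rewrite addr_ge0// linf_norm_ge0.
by rewrite (le_trans (cnormD _ _))// lerD// linf_norm_ub.
Qed.

Lemma linf_normM u v : linf_norm (u * v) <= linf_norm u * linf_norm v.
Proof.
apply: linf_norm_le => [|n]; first by rewrite mulr_ge0// linf_norm_ge0.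
by rewrite (le_trans (cnormM _ _))// ler_pM// ?cnorm_ge0 ?linf_norm_ub.
Qed.

Lemma linf_normZ a u : linf_norm (linf_scale a u) <= normc a * linf_norm u.
Proof.
apply: linf_norm_le => [|n]; first by rewrite mulr_ge0// ?normc_ge0 ?linf_norm_ge0.
by rewrite cnormZ ler_wpM2l ?normc_ge0 ?linf_norm_ub.
Qed.

Lemma linf_norm_star u : linf_norm (linf_star u) <= linf_norm u.
Proof.
apply: linf_norm_le => [|n]; first exact: linf_norm_ge0.
by rewrite cnorm_star linf_norm_ub.
Qed.

Definition c0_seq : {pred linf} :=
  fun u => `[< cnorm (u n) @[n --> \oo] --> (0 : R) >].

Lemma c0_seqP u : reflect (forall e, 0 < e -> exists N, forall n, (N <= n)%N ->
  cnorm (u n) < e) (u \in c0_seq).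
Proof.
by apply: (iffP (asboolP _)) => /cvg0P h; apply: h => n; exact: cnorm_ge0.
Qed.

Lemma c0_0 : 0 \in c0_seq.
Proof. by apply/c0_seqP => e e0; exists 0 => n _; rewrite cnorm0. Qed.

Lemma c0D u v : u \in c0_seq -> v \in c0_seq -> u + v \in c0_seq.
Proof.
move=> /c0_seqP hu /c0_seqP hv; apply/c0_seqP => e e0.
have e2 : 0 < e / 2 by rewrite divr_gt0.
have [N hN] := hu _ e2; have [M hM] := hv _ e2.
exists (maxn N M) => n; rewrite geq_max => /andP[Nn Mn].
by rewrite (le_lt_trans (cnormD _ _))// [ltRHS]splitr ltrD// ?hN ?hM.
Qed.

Lemma c0N u : u \in c0_seq -> - u \in c0_seq.
Proof.
move=> /c0_seqP hu; apply/c0_seqP => e /hu[N hN]; exists N => n Nn.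
by rewrite cnormN hN.
Qed.

Lemma c0_le M u v : (forall n, cnorm (v n) <= M * cnorm (u n)) ->
  u \in c0_seq -> v \in c0_seq.
Proof.
move=> h /c0_seqP hu; apply/c0_seqP => e e0.
have M1 : 0 < `|M| + 1 by rewrite ltr_wpDl.
have [|N hN] := hu (e / (`|M| + 1)); first by rewrite divr_gt0.
exists N => n /hN; rewrite ltr_pdivlMr// mulrC; apply: le_lt_trans.
by rewrite (le_trans (h n))// ler_wpM2r ?cnorm_ge0// ler_wpDr// ler_norm.
Qed.

Lemma c0Ml u v : v \in c0_seq -> u * v \in c0_seq.
Proof.
apply: (@c0_le (linf_norm u)) => n.
by rewrite (le_trans (cnormM _ _))// ler_wpM2r ?cnorm_ge0 ?linf_norm_ub.
Qed.

Lemma c0Mr u v : u \in c0_seq -> u * v \in c0_seq.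
Proof.
apply: (@c0_le (linf_norm v)) => n.
by rewrite (le_trans (cnormM _ _))// mulrC ler_wpM2r ?cnorm_ge0 ?linf_norm_ub.
Qed.

Lemma c0_scale a u : u \in c0_seq -> linf_scale a u \in c0_seq.
Proof. by apply: (@c0_le (normc a)) => n; rewrite cnormZ. Qed.

Lemma c0_star u : u \in c0_seq -> linf_star u \in c0_seq.
Proof. by apply: (@c0_le 1) => n; rewrite mul1r cnorm_star. Qed.

Definition linf_equiv u v := u - v \in c0_seq.

Fact linf_equiv_refl : reflexive linf_equiv.
Proof. by move=> u; rewrite /linf_equiv subrr c0_0. Qed.

Fact linf_equiv_sym : symmetric linf_equiv.
Proof.
by move=> u v; apply/idP/idP => /c0N; rewrite opprB.
Qed.

Fact linf_equiv_trans : transitive linf_equiv.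
Proof.
move=> v u w uv vw; rewrite /linf_equiv (_ : u - w = (u - v) + (v - w)).
  exact: c0D.
by rewrite addrA subrK.
Qed.

Canonical linf_equiv_rel :=
  EquivRel linf_equiv linf_equiv_refl linf_equiv_sym linf_equiv_trans.

(* A_oo *)
Definition ainf := {eq_quot linf_equiv_rel}.
HB.instance Definition _ : EqQuotient linf linf_equiv_rel ainf :=
  EqQuotient.on ainf.
HB.instance Definition _ := Choice.on ainf.

Definition pi_ainf u : ainf := \pi_ainf u.

Lemma pi_ainfP u v : pi_ainf u = pi_ainf v <-> u - v \in c0_seq.
Proof. by split=> [/eqmodP|h]; [|apply/eqmodP]. Qed.

Lemma ainfW (P : ainf -> Prop) : (forall u, P (pi_ainf u)) -> forall a, P a.
Proof. by move=> h a; rewrite -[a]reprK; exact: h. Qed.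

Lemma repr_pi u : repr (pi_ainf u) - u \in c0_seq.
Proof. by apply/pi_ainfP; exact: reprK. Qed.

Implicit Types a b c : ainf.

Definition ainf_add a b := pi_ainf (repr a + repr b).
Definition ainf_opp a := pi_ainf (- repr a).
Definition ainf_mul a b := pi_ainf (repr a * repr b).
Definition ainf_scale z a := pi_ainf (linf_scale z (repr a)).
Definition ainf_star a := pi_ainf (linf_star (repr a)).

(* The quotient norm. *)
Definition ainf_norm a : R := inf [set linf_norm u | u in [set u | pi_ainf u = a]].

Fact pi_add u v : ainf_add (pi_ainf u) (pi_ainf v) = pi_ainf (u + v).
Proof.
by apply/pi_ainfP; rewrite opprD addrACA; apply: c0D; exact: repr_pi.
Qed.

Fact pi_opp u : ainf_opp (pi_ainf u) = pi_ainf (- u).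
Proof. by apply/pi_ainfP; rewrite -opprD; apply: c0N; exact: repr_pi. Qed.

Fact pi_mul u v : ainf_mul (pi_ainf u) (pi_ainf v) = pi_ainf (u * v).
Proof.
apply/pi_ainfP; set x := repr _; set y := repr _.
have -> : x * y - u * v = (x - u) * y + u * (y - v).
  by rewrite mulrBl mulrBr addrA subrK.
by apply: c0D; [apply: c0Mr|apply: c0Ml]; exact: repr_pi.
Qed.

Fact pi_scale z u : ainf_scale z (pi_ainf u) = pi_ainf (linf_scale z u).
Proof.
apply/pi_ainfP; set x := repr _.
have -> : linf_scale z x - linf_scale z u = linf_scale z (x - u).
  apply: linfP => n.
  change (cscale z (x n) - cscale z (u n) = cscale z (x n - u n)).
  by rewrite cscaleDr -cscaleN1 -[- u n]cscaleN1 !cscaleA mulrC.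
by apply: c0_scale; exact: repr_pi.
Qed.

Fact pi_star u : ainf_star (pi_ainf u) = pi_ainf (linf_star u).
Proof.
apply/pi_ainfP; set x := repr _.
have -> : linf_star x - linf_star u = linf_star (x - u).
  apply: linfP => n.
  change (star (x n) - star (u n) = star (x n - u n)).
  by rewrite starD starN.
by apply: c0_star; exact: repr_pi.
Qed.

Fact ainf_addA : associative ainf_add.
Proof.
elim/ainfW=> u; elim/ainfW=> v; elim/ainfW=> w.
by rewrite !pi_add addrA.
Qed.
Fact ainf_addC : commutative ainf_add.
Proof. by elim/ainfW=> u; elim/ainfW=> v; rewrite !pi_add addrC. Qed.
Fact ainf_add0 : left_id (pi_ainf 0) ainf_add.
Proof. by elim/ainfW=> u; rewrite !pi_add add0r. Qed.
Fact ainf_addN : left_inverse (pi_ainf 0) ainf_opp ainf_add.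
Proof. by elim/ainfW=> u; rewrite pi_opp pi_add addNr. Qed.
HB.instance Definition _ :=
  GRing.isZmodule.Build ainf ainf_addA ainf_addC ainf_add0 ainf_addN.

Lemma pi_ainfD u v : pi_ainf (u + v) = pi_ainf u + pi_ainf v.
Proof. by rewrite -pi_add. Qed.
Lemma pi_ainfN u : pi_ainf (- u) = - pi_ainf u.
Proof. by rewrite -pi_opp. Qed.
Lemma pi_ainfB u v : pi_ainf (u - v) = pi_ainf u - pi_ainf v.
Proof. by rewrite pi_ainfD pi_ainfN. Qed.

Fact ainf_mulA : associative ainf_mul.
Proof.
elim/ainfW=> u; elim/ainfW=> v; elim/ainfW=> w.
by rewrite !pi_mul mulrA.
Qed.
Fact ainf_mul1 : left_id (pi_ainf 1) ainf_mul.
Proof. by elim/ainfW=> u; rewrite pi_mul mul1r. Qed.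
Fact ainf_mulr1 : right_id (pi_ainf 1) ainf_mul.
Proof. by elim/ainfW=> u; rewrite pi_mul mulr1. Qed.
Fact ainf_mulDl : left_distributive ainf_mul +%R.
Proof.
elim/ainfW=> u; elim/ainfW=> v; elim/ainfW=> w.
by rewrite -pi_ainfD !pi_mul -pi_ainfD mulrDl.
Qed.
Fact ainf_mulDr : right_distributive ainf_mul +%R.
Proof.
elim/ainfW=> u; elim/ainfW=> v; elim/ainfW=> w.
by rewrite -pi_ainfD !pi_mul -pi_ainfD mulrDr.
Qed.
HB.instance Definition _ := GRing.Zmodule_isPzRing.Build ainf
  ainf_mulA ainf_mul1 ainf_mulr1 ainf_mulDl ainf_mulDr.

Lemma pi_ainfM u v : pi_ainf (u * v) = pi_ainf u * pi_ainf v.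
Proof. by rewrite -pi_mul. Qed.
Lemma pi_ainf0 : pi_ainf 0 = 0. Proof. by []. Qed.
Lemma pi_ainf1 : pi_ainf 1 = 1. Proof. by []. Qed.

Lemma ainf_norm_has_inf a :
  has_inf [set linf_norm u | u in [set u | pi_ainf u = a]].
Proof.
split; first by exists (linf_norm (repr a)), (repr a) => //; exact: reprK.
by exists 0 => _ [u _ <-]; exact: linf_norm_ge0.
Qed.

Lemma ainf_norm_le u : ainf_norm (pi_ainf u) <= linf_norm u.
Proof.
apply: ge_inf; last by exists u.
exact: (ainf_norm_has_inf (pi_ainf u)).2.
Qed.

Lemma ainf_norm_lt a e : ainf_norm a < e ->
  exists2 u, pi_ainf u = a & linf_norm u < e.
Proof.
move=> h; have e0 : 0 < e - ainf_norm a by rewrite subr_gt0.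
have [_ [u ua <-]] := inf_adherent e0 (ainf_norm_has_inf a).
by rewrite addrCA subrr addr0 => ?; exists u.
Qed.

Lemma ainf_norm_ge a M :
  (forall u, pi_ainf u = a -> M <= linf_norm u) -> M <= ainf_norm a.
Proof.
move=> h; apply: lb_le_inf; first exact: (ainf_norm_has_inf a).1.
by move=> _ [u ua <-]; exact: h.
Qed.

Lemma ainf_norm_ge0 a : 0 <= ainf_norm a.
Proof. by apply: ainf_norm_ge => u _; exact: linf_norm_ge0. Qed.

Fact ainf_scaleA z w a : ainf_scale z (ainf_scale w a) = ainf_scale (z * w) a.
Proof.
elim/ainfW: a => u; rewrite !pi_scale; congr pi_ainf.
by apply: linfP => n; exact: cscaleA.
Qed.

Fact ainf_scale1 a : ainf_scale 1 a = a.
Proof.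
elim/ainfW: a => u; rewrite !pi_scale; congr pi_ainf.
by apply: linfP => n; exact: cscale1.
Qed.

Fact ainf_scaleDr z a b : ainf_scale z (a + b) = ainf_scale z a + ainf_scale z b.
Proof.
elim/ainfW: a => u; elim/ainfW: b => v.
rewrite -pi_ainfD !pi_scale -pi_ainfD; congr pi_ainf.
by apply: linfP => n; exact: cscaleDr.
Qed.

Fact ainf_scaleDl z w a : ainf_scale (z + w) a = ainf_scale z a + ainf_scale w a.
Proof.
elim/ainfW: a => u; rewrite !pi_scale -pi_ainfD; congr pi_ainf.
by apply: linfP => n; exact: cscaleDl.
Qed.

Fact ainf_scaleAl z a b : ainf_scale z (a * b) = ainf_scale z a * b.
Proof.
elim/ainfW: a => u; elim/ainfW: b => v.
rewrite -pi_ainfM !pi_scale -pi_ainfM; congr pi_ainf.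
by apply: linfP => n; exact: cscaleAl.
Qed.

Fact ainf_scaleAr z a b : ainf_scale z (a * b) = a * ainf_scale z b.
Proof.
elim/ainfW: a => u; elim/ainfW: b => v.
rewrite -pi_ainfM !pi_scale -pi_ainfM; congr pi_ainf.
by apply: linfP => n; exact: cscaleAr.
Qed.

Fact ainf_starK a : ainf_star (ainf_star a) = a.
Proof.
elim/ainfW: a => u; rewrite !pi_star; congr pi_ainf.
by apply: linfP => n; exact: starK.
Qed.

Fact ainf_starD a b : ainf_star (a + b) = ainf_star a + ainf_star b.
Proof.
elim/ainfW: a => u; elim/ainfW: b => v.
rewrite -pi_ainfD !pi_star -pi_ainfD; congr pi_ainf.
by apply: linfP => n; exact: starD.
Qed.

Fact ainf_starM a b : ainf_star (a * b) = ainf_star b * ainf_star a.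
Proof.
elim/ainfW: a => u; elim/ainfW: b => v.
rewrite -pi_ainfM !pi_star -pi_ainfM; congr pi_ainf.
by apply: linfP => n; exact: starM.
Qed.

Fact ainf_starZ z a : ainf_star (ainf_scale z a) = ainf_scale z^* (ainf_star a).
Proof.
elim/ainfW: a => u; rewrite pi_scale !pi_star pi_scale; congr pi_ainf.
by apply: linfP => n; exact: starZ.
Qed.

Fact ainf_normD a b : ainf_norm (a + b) <= ainf_norm a + ainf_norm b.
Proof.
apply: le_of_lt => t; rewrite -ltrBrDr => /ainf_norm_lt[u <- ut].
have : ainf_norm b < t - linf_norm u by rewrite ltrBrDr -ltrBrDl.
move=> /ainf_norm_lt[v <- vt]; rewrite -pi_ainfD (le_trans (ainf_norm_le _))//.
by rewrite (le_trans (linf_normD _ _))// -lerBrDl ltW.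
Qed.

Fact ainf_normM a b : ainf_norm (a * b) <= ainf_norm a * ainf_norm b.
Proof.
apply: le_mul_of_lt; rewrite ?ainf_norm_ge0// => s t.
move=> /ainf_norm_lt[u <- us] /ainf_norm_lt[v <- vt].
rewrite -pi_ainfM (le_trans (ainf_norm_le _))// (le_trans (linf_normM _ _))//.
by rewrite ler_pM ?linf_norm_ge0// ltW.
Qed.

Fact ainf_normZ_le z a : ainf_norm (ainf_scale z a) <= normc z * ainf_norm a.
Proof.
apply: le_mul_of_lt; rewrite ?normc_ge0 ?ainf_norm_ge0// => s t zs.
move=> /ainf_norm_lt[u <- ut].
rewrite pi_scale (le_trans (ainf_norm_le _))// (le_trans (linf_normZ _ _))//.
by rewrite ler_pM ?linf_norm_ge0 ?normc_ge0// ltW.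
Qed.

Fact ainf_normZ z a : ainf_norm (ainf_scale z a) = normc z * ainf_norm a.
Proof.
apply/eqP; rewrite eq_le ainf_normZ_le/=.
have [->|z0] := eqVneq z 0; first by rewrite normc0 mul0r ainf_norm_ge0.
have nz : 0 < normc z.
  by rewrite lt0r normc_ge0 andbT; apply: contra z0 => /eqP/eq0_normc ->.
have := ainf_normZ_le z^-1 (ainf_scale z a).
by rewrite ainf_scaleA mulVf// ainf_scale1 normcV -ler_pdivrMl ?invr_gt0// invrK.
Qed.

Fact ainf_norm0_eq0 a : ainf_norm a = 0 -> a = 0.
Proof.
move=> a0; rewrite -[a]reprK -pi_ainf0; apply/pi_ainfP; rewrite subr0.
apply/c0_seqP => e e0; have e2 : 0 < e / 2 by rewrite divr_gt0.
have : ainf_norm a < e / 2 by rewrite a0.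
move=> /ainf_norm_lt[u ua ue].
have /c0_seqP/(_ _ e2)[N hN] : repr a - u \in c0_seq.
  by apply/pi_ainfP; rewrite ua; exact: reprK.
exists N => n /hN; rewrite linfB => h.
rewrite -(subrK (u n) (repr a n)) (le_lt_trans (cnormD _ _))// [ltRHS]splitr.
by rewrite ltrD// (le_lt_trans (linf_norm_ub _ _)).
Qed.

Fact ainf_norm_star_le a : ainf_norm (ainf_star a) <= ainf_norm a.
Proof.
apply: le_of_lt => t /ainf_norm_lt[u <- ut].
rewrite pi_star (le_trans (ainf_norm_le _))// (le_trans (linf_norm_star _))//.
exact: ltW.
Qed.

Fact tail_bounded N u :
  exists M, forall n, cnorm (if (n < N)%N then 0 else u n) <= M.
Proof.
have [M uM] := linf_bounded u; exists M => n; case: ifP => // _.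
by rewrite cnorm0 (le_trans (cnorm_ge0 (u n))).
Qed.

Lemma pi_tail N u : pi_ainf (mklinf (tail_bounded N u)) = pi_ainf u.
Proof.
apply/pi_ainfP/c0_seqP => e e0; exists N => n Nn.
by rewrite linfB /= ltnNge Nn/= subrr cnorm0.
Qed.

Fact ainf_norm_starM a : ainf_norm (ainf_star a * a) = ainf_norm a ^+ 2.
Proof.
apply/eqP; rewrite eq_le; apply/andP; split.
  rewrite (le_trans (ainf_normM _ _))// expr2 ler_wpM2r ?ainf_norm_ge0//.
  exact: ainf_norm_star_le.
elim/ainfW: a => u; rewrite pi_star -pi_ainfM; apply: ainf_norm_ge => v uv.
apply/ler_addgt0Pr => e e0.
have /c0_seqP/(_ _ e0)[N hN] : linf_star u * u - v \in c0_seq.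
  by apply/pi_ainfP; rewrite uv.
have ve : 0 <= linf_norm v + e by rewrite addr_ge0 ?linf_norm_ge0 ?ltW.
rewrite -(sqr_sqrtr ve) lerXn2r ?nnegrE ?ainf_norm_ge0 ?sqrtr_ge0//.
rewrite -(pi_tail N) (le_trans (ainf_norm_le _))//.
apply: linf_norm_le => [|n /=]; first exact: sqrtr_ge0.
case: ltnP => [_|Nn]; first by rewrite cnorm0 sqrtr_ge0.
rewrite -[leLHS]ger0_norm ?cnorm_ge0// -sqrtr_sqr ler_sqrt//.
rewrite -cnorm_starM -(subrK (v n) (star (u n) * u n)) addrC.
rewrite (le_trans (cnormD _ _))// lerD ?linf_norm_ub// ltW//.
by have := hN n Nn.
Qed.

Lemma half_sum (x : nat -> A) k :
  (forall j, cnorm (x j.+1 - x j) <= 2^-1 ^+ j) ->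
  forall m, (k <= m)%N -> cnorm (x m - x k) <= 2 * 2^-1 ^+ k.
Proof.
move=> h m km; rewrite -(subnKC km); move: (m - k)%N => {m km} d.
have p j : 0 <= (2^-1 : R) ^+ j by rewrite exprn_ge0 ?invr_ge0.
suff : cnorm (x (k + d)%N - x k) <= 2 * 2^-1 ^+ k - 2 * 2^-1 ^+ (k + d).
  by move=> /le_trans; apply; rewrite gerBl mulr_ge0.
elim: d => [|d IH]; first by rewrite addn0 !subrr cnorm0.
rewrite addnS (le_trans (cnorm_dist _ (x (k + d)%N) _))//.
rewrite (le_trans (lerD (h _) IH))// exprS; lra.
Qed.

Lemma fast_complete (v : nat -> ainf) :
  (forall k, ainf_norm (v k.+1 - v k) < 2^-1 ^+ k) ->
  exists l, forall k, ainf_norm (v k - l) <= 2 * 2^-1 ^+ k.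
Proof.
move=> h.
have /choice[y hy] k : exists u : linf,
    pi_ainf u = v k.+1 - v k /\ linf_norm u < 2^-1 ^+ k.
  by have [u uk ue] := ainf_norm_lt (h k); exists u.
pose x := fix x k : linf := if k is k'.+1 then x k' + y k' else repr (v 0%N).
have pix k : pi_ainf (x k) = v k.
  elim: k => [|k IH]; first exact: reprK.
  by rewrite [x _]/= pi_ainfD IH (hy k).1 addrC subrK.
have xS n j : cnorm (x j.+1 n - x j n) <= 2^-1 ^+ j.
  rewrite [x _]/= linfD addrC addKr (le_trans (linf_norm_ub _ _))// ltW//.
  exact: (hy j).2.
have /choice[l hl] n : exists l, cnorm (x k n - l) @[k --> \oo] --> (0 : R).
  apply: cnorm_complete => e e0.
  have [|K hK] := @exists_half_lt R (e / 4); first by rewrite divr_gt0.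
  exists K => i j Ki Kj; rewrite (le_lt_trans (cnorm_dist _ (x K n) _))//.
  rewrite (cnormB (x K n)).
  have := half_sum (xS n) Ki; have := half_sum (xS n) Kj; lra.
have bnd n k : cnorm (x k n - l n) <= 2 * 2^-1 ^+ k.
  apply/ler_addgt0Pr => e e0.
  have [|N hN] := (cvg0P _).1 (hl n) e e0; first by move=> i; exact: cnorm_ge0.
  pose m := maxn N k.
  rewrite (le_trans (cnorm_dist _ (x m n) _))// lerD//; last first.
    by rewrite ltW// hN// leq_maxl.
  rewrite cnormB; exact: (@half_sum (fun j => x j n) k (xS n) m (leq_maxr N k)).
have lb : exists M, forall n, cnorm (l n) <= M.
  have [M hM] := linf_bounded (x 0); exists (2 + M) => n.
  rewrite -(subrK (x 0%N n) (l n)) (le_trans (cnormD _ _))// lerD// cnormB.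
  by have := bnd n 0; rewrite expr0 mulr1.
exists (pi_ainf (mklinf lb)) => k; rewrite -pix -pi_ainfB.
rewrite (le_trans (ainf_norm_le _))//; apply: linf_norm_le => [|n].
  by rewrite mulr_ge0// exprn_ge0 ?invr_ge0.
exact: bnd.
Qed.

Fact ainf_norm_complete (u : nat -> ainf) :
  (forall e, 0 < e -> exists N, forall m n,
     (N <= m)%N -> (N <= n)%N -> ainf_norm (u m - u n) < e) ->
  exists l, ainf_norm (u n - l) @[n --> \oo] --> (0 : R).
Proof.
move=> h.
have /choice[f hf] k : exists N, forall m n,
    (N <= m)%N -> (N <= n)%N -> ainf_norm (u m - u n) < 2^-1 ^+ k.
  by apply: h; rewrite exprn_gt0 ?invr_gt0.
pose g := fix g k := if k is k'.+1 then maxn (g k') (f k) else f 0%N.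
have fg k : (f k <= g k)%N by case: k => //= k; exact: leq_maxr.
have gS k : (g k <= g k.+1)%N by exact: leq_maxl.
have [|l hl] := @fast_complete (u \o g).
  by move=> k /=; apply: hf; rewrite ?(leq_trans (fg k)).
exists l; apply/cvg0P => [n|e e0]; first exact: ainf_norm_ge0.
have [|K hK] := @exists_half_lt R (e / 3); first by rewrite divr_gt0.
exists (g K) => n Kn; rewrite -(subrK (u (g K)) (u n)) -addrA.
rewrite (le_lt_trans (ainf_normD _ _))//.
have := hl K; have := hf K n (g K) (leq_trans (fg K) Kn) (fg K).
rewrite /=; lra.
Qed.

HB.instance Definition _ := isCStarAlgebra.Build R ainf
  ainf_scaleA ainf_scale1 ainf_scaleDr ainf_scaleDl ainf_scaleAl ainf_scaleAr
  ainf_starK ainf_starD ainf_starM ainf_starZ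
  ainf_normD ainf_normZ ainf_norm0_eq0 ainf_normM ainf_norm_starM
  ainf_norm_complete.

Definition ainf_cst (x : A) : ainf := pi_ainf (linf_cst x).

Lemma ainf_cst_star x : ainf_cst (star x) = star (ainf_cst x).
Proof. by rewrite /ainf_cst /star/= pi_star; congr pi_ainf; apply: linfP. Qed.

Definition central_seq : {pred ainf} :=
  fun a => `[< forall x : A, ainf_cst x * a = a * ainf_cst x >].

(* The relative commutant of the constant sequences A in A_oo. *)
Record commutant :=
  Commutant { commutant_val :> ainf; _ : commutant_val \in central_seq }.

HB.instance Definition _ := [isSub for commutant_val].
HB.instance Definition _ := [Choice of commutant by <:].

Fact central_seq_subring : subring_closed central_seq.
Proof.
split=> [|a b /asboolP ha /asboolP hb|a b /asboolP ha /asboolP hb];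
    apply/asboolP => x.
- by rewrite mulr1 mul1r.
- by rewrite mulrBl mulrBr ha hb.
- by rewrite mulrA ha -!mulrA hb.
Qed.

HB.instance Definition _ :=
  GRing.SubChoice_isSubPzRing.Build _ _ commutant central_seq_subring.

Implicit Types s t : commutant.

Lemma commutantP s : forall x, ainf_cst x * (s : ainf) = (s : ainf) * ainf_cst x.
Proof. by case: s => a ca; apply/asboolP; exact: ca. Qed.

Fact central_scale z s : cscale z (s : ainf) \in central_seq.
Proof. by apply/asboolP => x; rewrite -cscaleAl -cscaleAr commutantP. Qed.

Fact central_star s : star (s : ainf) \in central_seq.
Proof.
apply/asboolP => x; rewrite -(starK x) ainf_cst_star -!starM.
by rewrite commutantP.
Qed.

Definition commutant_scale z s := Commutant (central_scale z s).
Definition commutant_star s := Commutant (central_star s).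
Definition commutant_norm s := cnorm (s : ainf).

Fact commutant_scaleA z w s :
  commutant_scale z (commutant_scale w s) = commutant_scale (z * w) s.
Proof. by apply: val_inj; exact: cscaleA. Qed.
Fact commutant_scale1 s : commutant_scale 1 s = s.
Proof. by apply: val_inj; exact: cscale1. Qed.
Fact commutant_scaleDr z s t :
  commutant_scale z (s + t) = commutant_scale z s + commutant_scale z t.
Proof. by apply: val_inj; exact: cscaleDr. Qed.
Fact commutant_scaleDl z w s :
  commutant_scale (z + w) s = commutant_scale z s + commutant_scale w s.
Proof. by apply: val_inj; exact: cscaleDl. Qed.
Fact commutant_scaleAl z s t :
  commutant_scale z (s * t) = commutant_scale z s * t.
Proof. by apply: val_inj; exact: cscaleAl. Qed.
Fact commutant_scaleAr z s t :
  commutant_scale z (s * t) = s * commutant_scale z t.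
Proof. by apply: val_inj; exact: cscaleAr. Qed.
Fact commutant_starK s : commutant_star (commutant_star s) = s.
Proof. by apply: val_inj; exact: starK. Qed.
Fact commutant_starD s t :
  commutant_star (s + t) = commutant_star s + commutant_star t.
Proof. by apply: val_inj; exact: starD. Qed.
Fact commutant_starM s t :
  commutant_star (s * t) = commutant_star t * commutant_star s.
Proof. by apply: val_inj; exact: starM. Qed.
Fact commutant_starZ z s :
  commutant_star (commutant_scale z s) = commutant_scale z^* (commutant_star s).
Proof. by apply: val_inj; exact: starZ. Qed.
Fact commutant_normD s t :
  commutant_norm (s + t) <= commutant_norm s + commutant_norm t.
Proof. exact: cnormD. Qed.
Fact commutant_normZ z s :
  commutant_norm (commutant_scale z s) = normc z * commutant_norm s.
Proof. exact: cnormZ. Qed.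
Fact commutant_norm0_eq0 s : commutant_norm s = 0 -> s = 0.
Proof. by move=> s0; apply: val_inj; exact: cnorm0_eq0. Qed.
Fact commutant_normM s t :
  commutant_norm (s * t) <= commutant_norm s * commutant_norm t.
Proof. exact: cnormM. Qed.
Fact commutant_norm_starM s :
  commutant_norm (commutant_star s * s) = commutant_norm s ^+ 2.
Proof. exact: cnorm_starM. Qed.

Fact commutant_complete (u : nat -> commutant) :
  (forall e, 0 < e -> exists N, forall m n,
     (N <= m)%N -> (N <= n)%N -> commutant_norm (u m - u n) < e) ->
  exists l, commutant_norm (u n - l) @[n --> \oo] --> (0 : R).
Proof.
move=> h; have [l hl] := @cnorm_complete R ainf (fun n => u n : ainf) h.
have lc : l \in central_seq.
  apply/asboolP => x; apply/eqP; rewrite -subr_eq0; apply/eqP/cnorm0_eq0.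
  apply/eqP; rewrite eq_le cnorm_ge0 andbT; apply/ler_addgt0Pr => e e0.
  rewrite add0r; set c := ainf_cst x.
  have c1 : 0 < 2 * cnorm c + 1 by rewrite ltr_wpDl// mulr_ge0 ?cnorm_ge0.
  have [||N hN] := (cvg0P _).1 hl (e / (2 * cnorm c + 1)).
  - by move=> n; exact: cnorm_ge0.
  - by rewrite divr_gt0.
  have -> : c * l - l * c = ((u N : ainf) - l) * c - c * ((u N : ainf) - l).
    by rewrite mulrBl mulrBr opprB -(commutantP (u N)) [RHS]addrC addrA subrK.
  have /ltW := hN N (leqnn N); rewrite ler_pdivlMr// => ule.
  rewrite (le_trans (cnormD _ _))// cnormN (le_trans _ ule)//.
  rewrite (le_trans (lerD (cnormM _ _) (cnormM _ _)))//.
  have := cnorm_ge0 ((u N : ainf) - l); lra.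
by exists (Commutant lc).
Qed.

HB.instance Definition _ := isCStarAlgebra.Build R commutant
  commutant_scaleA commutant_scale1 commutant_scaleDr commutant_scaleDl
  commutant_scaleAl commutant_scaleAr
  commutant_starK commutant_starD commutant_starM commutant_starZ
  commutant_normD commutant_normZ commutant_norm0_eq0 commutant_normM
  commutant_norm_starM commutant_complete.

End BoundedSequences.

Section CompletelyPositive.
Variables (R : realType) (A B : cstarAlgType R).
Implicit Type phi : A -> B.

Definition starmx (C : cstarAlgType R) n (M : 'M[C]_n) : 'M[C]_n :=
  map_mx star M^T.

(* Positivity in the C*-algebra M_n(C), as being of the form N^* N. *)
Definition mxpositive (C : cstarAlgType R) n (M : 'M[C]_n) : Prop :=
  exists N : 'M[C]_n, M = starmx N *m N.

Definition clinear phi : Prop :=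
  (forall x y, phi (x + y) = phi x + phi y) /\
  (forall z x, phi (cscale z x) = cscale z (phi x)).

Definition completely_positive phi : Prop :=
  forall n (M : 'M[A]_n), mxpositive M -> mxpositive (map_mx phi M).

Definition contractive phi : Prop := forall x, cnorm (phi x) <= cnorm x.

Definition order_zero phi : Prop := forall x y, x * y = 0 -> phi x * phi y = 0.

Definition cpc_order_zero phi : Prop :=
  [/\ clinear phi, completely_positive phi, contractive phi & order_zero phi].

End CompletelyPositive.

(* A continuous action of G by automorphisms of A. *-automorphisms of a
   C*-algebra are automatically isometric; act_cnorm records this fact, which
   is what makes the componentwise action on bounded sequences well defined. *)
Record cstar_action (R : realType) (G : topologicalZmodType)
    (A : cstarAlgType R) := CStarAction {
  act :> G -> A -> A;
  act0 : forall x, act 0 x = x;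
  actA : forall g h x, act (g + h) x = act g (act h x);
  act_add : forall g x y, act g (x + y) = act g x + act g y;
  act_scale : forall g z x, act g (cscale z x) = cscale z (act g x);
  act_mul : forall g x y, act g (x * y) = act g x * act g y;
  act_one : forall g, act g 1 = 1;
  act_star : forall g x, act g (star x) = star (act g x);
  act_cnorm : forall g x, cnorm (act g x) = cnorm x;
  act_continuous : forall g x, cnorm (act h x - act g x) @[h --> g] --> (0 : R)
}.

Section InducedOnSequences.
Variables (R : realType) (G : topologicalZmodType) (A : cstarAlgType R).
Variable delta : cstar_action G A.

Fact linf_act_bounded g (u : linf A) :
  exists M, forall n, cnorm (delta g (u n)) <= M.
Proof.
by have [M uM] := linf_bounded u; exists M => n; rewrite act_cnorm.
Qed.

Definition linf_act g (u : linf A) : linf A := mklinf (linf_act_bounded g u).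

Definition ainf_act g (a : ainf A) : ainf A := pi_ainf (linf_act g (repr a)).

Lemma ainf_act_pi g u : ainf_act g (pi_ainf u) = pi_ainf (linf_act g u).
Proof.
apply/pi_ainfP; apply: (@c0_le _ _ 1 (repr (pi_ainf u) - u)); last first.
  exact: repr_pi.
move=> n; rewrite mul1r; set v := repr _.
rewrite !linfB -[leRHS](act_cnorm delta g).
rewrite -[- u n]cscaleN1 act_add act_scale cscaleN1.
exact: lexx.
Qed.

End InducedOnSequences.

Record space_action (G : topologicalZmodType) (X : topologicalType) :=
  SpaceAction {
  sact :> G -> X -> X;
  sact0 : forall x, sact 0 x = x;
  sactA : forall g h x, sact (g + h) x = sact g (sact h x);
  sact_continuous : continuous (fun gx : G * X => sact gx.1 gx.2)
}.

Section InducedOnFunctions.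
Variables (R : realType) (G : topologicalZmodType) (X : compactType).
Variable alpha : space_action G X.
Implicit Types f : Cfun R X.

Fact pullback_cts g f : continuous (fun x => f (alpha (- g) x)).
Proof.
move=> x; apply: (@continuous_comp _ _ _ (alpha (- g)) f); last first.
  exact: Cfun_continuous.
apply: (@continuous_comp _ _ _ (fun y => (- g, y)) (fun gx => alpha gx.1 gx.2)).
  by apply: cvg_pair => /=; [exact: cvg_cst|exact: cvg_id].
exact: sact_continuous.
Qed.

(* (g . f)(x) = f(g^-1 x). *)
Definition pullback g f : Cfun R X := mkCfun (@pullback_cts g f).

Fact pullback0 f : pullback 0 f = f.
Proof.
by apply: CfunP => x; change (f (alpha (- 0) x) = f x); rewrite oppr0 sact0.
Qed.

Fact pullbackA g h f : pullback (g + h) f = pullback g (pullback h f).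
Proof.
apply: CfunP => x.
change (f (alpha (- (g + h)) x) = f (alpha (- h) (alpha (- g) x))).
by rewrite -sactA opprD addrC.
Qed.

Fact pullback_cnorm g f : cnorm (pullback g f) = cnorm f.
Proof.
have le h k : cnorm (pullback h k) <= cnorm k.
  apply: Cfun_norm_le => [|x]; first exact: Cfun_norm_ge0.
  exact: (Cfun_norm_ub k).
apply/eqP; rewrite eq_le le/=.
by rewrite -{1}(pullback0 f) -(addNr g) pullbackA le.
Qed.

Fact pullback_continuous g f :
  cnorm (pullback h f - pullback g f) @[h --> g] --> (0 : R).
Proof.
apply/cvgrPdist_le => e e0.
have e2 : 0 < e / 2 by rewrite divr_gt0.
have : \forall h \near g, forall x, [set: X] x ->
    normc (f (alpha (- h) x) - f (alpha (- g) x)) < e.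
  have /compact_near_coveringP := @compactT X; apply => x _.
  have c : {for (g, x), continuous (fun gx : G * X => f (alpha (- gx.1) gx.2))}.
    apply: (@continuous_comp _ _ _ (fun gx : G * X => alpha (- gx.1) gx.2) f).
      apply: (@continuous_comp _ _ _ (fun gx : G * X => (- gx.1, gx.2))
        (fun gx => alpha gx.1 gx.2)); last exact: sact_continuous.
      have c1 : {for (g, x), continuous (fun gx : G * X => - gx.1)}.
        apply: (@continuous_comp (G * X)%type G G fst -%R); first exact: cvg_fst.
        exact: opp_continuous.
      by apply: cvg_pair; [exact: c1|exact: cvg_snd].
    exact: Cfun_continuous.
  have /(_ _ _ e2) := (cvgcP _ _ _).1 c.
  case=> -[U V] /= [Ug Vx] UV.
  exists (V, U) => // -[y h] /= [Vy Uh].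
  have Ugg := nbhs_singleton Ug.
  have h1 := UV (h, y) (conj Uh Vy); have h2 := UV (g, y) (conj Ugg Vy).
  rewrite /= in h1 h2; set a := f (alpha (- g) x) in h1 h2.
  rewrite -(subrK a (f (alpha (- h) y))) -addrA.
  rewrite (le_lt_trans (le_normcD _ _))// [ltRHS]splitr ltrD//.
  by rewrite -normcN opprB.
apply: filterS => h hh; rewrite sub0r normrN ger0_norm ?cnorm_ge0//.
by apply: Cfun_norm_le => [|x]; [exact: ltW|exact/ltW/hh].
Qed.

Fact pullback_add g f k : pullback g (f + k) = pullback g f + pullback g k.
Proof. exact: CfunP. Qed.

Fact pullback_scale g z f : pullback g (cscale z f) = cscale z (pullback g f).
Proof. exact: CfunP. Qed.

Fact pullback_mul g f k : pullback g (f * k) = pullback g f * pullback g k.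
Proof. exact: CfunP. Qed.

Fact pullback_one g : pullback g 1 = 1.
Proof. exact: CfunP. Qed.

Fact pullback_star g f : pullback g (star f) = star (pullback g f).
Proof. exact: CfunP. Qed.

Definition induced_action : cstar_action G (Cfun R X) := CStarAction
  pullback0 pullbackA pullback_add pullback_scale pullback_mul pullback_one
  pullback_star pullback_cnorm pullback_continuous.

End InducedOnFunctions.

Definition translation (G : topologicalZmodType) : space_action G G :=
  @SpaceAction G G +%R (@add0r G) (fun g h x => esym (addrA g h x))
    (@add_continuous G).

Section RokhlinDimension.
Variables (R : realType) (G : compactZmodType) (A : cstarAlgType R).
Variable delta : cstar_action G A.

(* The action on A_oo preserves the commutant, so equivariance is an equation
   in A_oo. *)
Definition equivariant (phi : Cfun R G -> commutant A) : Prop :=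
  forall g f, phi (induced_action R (translation G) g f)
              = ainf_act delta g (phi f) :> ainf A.

Definition rokhlin_maps (n : nat) : Prop :=
  exists phi : 'I_n.+1 -> Cfun R G -> commutant A,
    [/\ forall i, cpc_order_zero (phi i),
        forall i, equivariant (phi i) &
        \sum_i phi i 1 = 1].

(* G is abelian, as in the case of Z_p. Separability of A and metrizability of G
   play no role in the definition. *)
Definition dimRok : \bar R :=
  if pselect (exists n, `[< rokhlin_maps n >]) is left ex
  then (ex_minn ex)%:R%:E else +oo%E.

End RokhlinDimension.

(* 'Z_(p ^ i.+1) is Z/p^(i+1) for p prime; indexing from p^1 avoids 'Z_1, which
   is not trivial. *)
Record padicInt (p : nat) := PadicInt {
  residue : forall i : nat, 'Z_(p ^ i.+1);
  residueS : forall i, inZp (residue i.+1) = residue i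
}.

Section PadicIntegers.
Variable p : nat.
Implicit Types x y z : padicInt p.

Lemma padicIntP x y : (forall i, residue x i = residue y i) -> x = y.
Proof.
case: x y => [x xS] [y yS] /= xy.
have {}xy : x = y by apply: functional_extensionality_dep.
by case: _ / xy yS => yS; congr PadicInt; exact: Prop_irrelevance.
Qed.

HB.instance Definition _ := gen_eqMixin (padicInt p).
HB.instance Definition _ := gen_choiceMixin (padicInt p).

Fact Zp_pow_dvd i : ((Zp_trunc (p ^ i.+1)).+2 %| (Zp_trunc (p ^ i.+2)).+2)%N.
Proof.
case: p => [|[|q]]; rewrite ?exp1n ?exp0n//.
have h j : (1 < q.+2 ^ j.+1)%N by rewrite -{1}(exp1n j.+1) ltn_exp2r.
by rewrite !Zp_cast// dvdn_exp2l.
Qed.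

Fact padic_zeroS i : inZp (0%R : 'Z_(p ^ i.+2)) = 0 :> 'Z_(p ^ i.+1).
Proof. by apply: val_inj; rewrite /= mod0n. Qed.

Fact padic_addS x y i :
  inZp (residue x i.+1 + residue y i.+1)%R = residue x i + residue y i.
Proof.
rewrite -(residueS x i) -(residueS y i); apply: val_inj => /=.
by rewrite modn_dvdm ?Zp_pow_dvd// modnDm.
Qed.

Fact padic_oppS x i : inZp (- residue x i.+1)%R = - residue x i.
Proof.
apply: (@addrI _ (residue x i)); rewrite subrr -[residue x i](residueS x i).
transitivity (inZp (residue x i.+1 - residue x i.+1)%R : 'Z_(p ^ i.+1)).
  by apply: val_inj => /=; rewrite [RHS]modn_dvdm ?Zp_pow_dvd// modnDm.
by rewrite subrr padic_zeroS.
Qed.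

Definition padic_zero := PadicInt padic_zeroS.
Definition padic_add x y := PadicInt (padic_addS x y).
Definition padic_opp x := PadicInt (padic_oppS x).

Fact padic_addA : associative padic_add.
Proof. by move=> x y z; apply: padicIntP => i; exact: addrA. Qed.
Fact padic_addC : commutative padic_add.
Proof. by move=> x y; apply: padicIntP => i; exact: addrC. Qed.
Fact padic_add0 : left_id padic_zero padic_add.
Proof. by move=> x; apply: padicIntP => i; exact: add0r. Qed.
Fact padic_addN : left_inverse padic_zero padic_opp padic_add.
Proof. by move=> x; apply: padicIntP => i; exact: addNr. Qed.
HB.instance Definition _ := GRing.isZmodule.Build (padicInt p)
  padic_addA padic_addC padic_add0 padic_addN.

(* The subspace topology from the product of the discrete groups. *)
Definition residues x :
    prod_topology (fun i : nat => discrete_topology 'Z_(p ^ i.+1)) :=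
  fun i => residue x i.

HB.instance Definition _ :=
  Topological.copy (padicInt p) (initial_topology residues).

Lemma nbhs_residue x i : \forall y \near x, residue y i = residue x i.
Proof.
have c : {for x, continuous (fun y : padicInt p => residues y i)}.
  apply: (@continuous_comp _ _ _ residues (proj i)).
    exact: initial_continuous.
  exact: proj_continuous.
apply: (c [set residue x i]).
exact: (@discrete_set1 (discrete_topology 'Z_(p ^ i.+1))).
Qed.

Lemma cvg_padic (F : set_system (padicInt p)) x : Filter F ->
  (forall i, F [set y | residue y i = residue x i]) -> F --> x.
Proof.
move=> FF h; have {}h : residues @ F --> residues x.
  apply/cvg_sup => i U [_ [[B _ <-]] /= Bx BU].
  suff : F [set y | U (residues y)] by [].
  apply: filterS (h i) => y /= yx; apply: BU => /=.
  by rewrite /residues yx.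
move=> U [_ [[B Bo <-] /= Bx] BU]; apply: filterS BU _.
by apply: h; exact: open_nbhs_nbhs.
Qed.

Fact padic_sub_continuous :
  continuous (fun x : padicInt p * padicInt p => x.1 - x.2).
Proof.
move=> [x y]; apply: cvg_padic => i /=.
exists ([set z | residue z i = residue x i], [set z | residue z i = residue y i]).
  by split; exact: nbhs_residue.
by move=> -[a b] /= [ax bx]; rewrite ax bx.
Qed.

HB.instance Definition _ :=
  PreTopologicalNmodule_isTopologicalZmodule.Build (padicInt p)
    padic_sub_continuous.

Fact padic_compact : compact [set: padicInt p].
Proof.
move=> F FF _.
have cK : compact [set: prod_topology
    (fun i : nat => discrete_topology 'Z_(p ^ i.+1))].
  have fK i : compact [set: discrete_topology 'Z_(p ^ i.+1)].
    by apply: finite_compact; exact: (@finite_finset 'Z_(p ^ i.+1)).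
  have := tychonoff fK; congr (compact _).
  by rewrite predeqE.
have [y [_ yF]] := cK (residues @ F) _ filterT.
have near_y i : nbhs y [set z | z i = y i].
  apply: (@proj_continuous _ (fun i => discrete_topology 'Z_(p ^ i.+1)) i y
    [set y i]).
  exact: (@discrete_set1 (discrete_topology 'Z_(p ^ i.+1))).
have yS i : inZp (y i.+1 : 'Z_(p ^ i.+2)) = (y i : 'Z_(p ^ i.+1)).
  have [||_ [[z _ <-] [/= <- <-]]] :=
    yF (range residues) ([set z | z i = y i] `&` [set z | z i.+1 = y i.+1]).
  - suff : F [set z | range residues (residues z)] by [].
    by apply: filterS filterT => z _; exists z.
  - by apply: filterI; exact: near_y.
  - exact: residueS.
exists (PadicInt yS); split=> // U V FU [_ [[B Bo <-] /= By] BV].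
have [||_ [[z Uz <-] Bz]] := yF (residues @` U) B.
- suff : F [set z | (residues @` U) (residues z)] by [].
  by apply: filterS FU => z Uz; exists z.
- exact: open_nbhs_nbhs.
- by exists z; split=> //; exact: BV.
Qed.

HB.instance Definition _ := isCompactSpace.Build (padicInt p) padic_compact.

End PadicIntegers.

(* Main.v *)
(* A Rokhlin system of dimension D gives, for every i, a Z_p-equivariant map from
   X to the join of D + 1 copies of Z/p^(i+1): the images of the indicator
   functions of cosets lift to sequences in C(X), which are invariant under the
   subgroup p^(i+1)Z_p up to a uniformly small error (a Baire category argument),
   and an infimum over cosets makes one of their terms exactly equivariant.
   Conversely, such maps for all i, with values in joins of d + 1 copies, give a
   Rokhlin system of dimension d.

   It remains to map the join of 4 + (d + 1) copies of Z/q^2 equivariantly to the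
   join of 4 + d copies of Z/q, where q is a power of p.  Realize Z/q^2 as roots
   of unity.  Two pairs of coordinates combine into complex numbers a and b, and
   the q-th power t of a fifth coordinate satisfies t^q >= 0.  Then
     P = a^(q-1) b - t   and   Q = b^q + conj(a)^(q(q-1))
   transform under the character of Z/q, and they vanish together only when
   a = b = t = 0: Q = 0 forces (a^(q-1) b)^q = - |a|^(2q(q-1)) <= 0, while P = 0
   makes the left-hand side t^q >= 0.  Finally, a number v that transforms under
   this character gives two coordinates: the q-th roots of unity nearest to v and
   to theta v, weighted so as to vanish at ties.  Ties at v and theta v exclude
   each other when theta^q = i. *)

Require Import Defs.
From HB Require Import structures.
From mathcomp Require Import all_boot all_order all_algebra complex.
From mathcomp Require Import all_classical all_reals all_analysis.
From mathcomp Require Import separable cyclic cyclotomic.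
From mathcomp Require Import ring lra.

Set Implicit Arguments.
Unset Strict Implicit.
Unset Printing Implicit Defensive.

Import Order.TTheory GRing.Theory Num.Theory numFieldNormedType.Exports.
Import Normc.

Local Open Scope classical_set_scope.
Local Open Scope ring_scope.
Local Open Scope complex_scope.
(* In [complex_scope] alone, this notation is shadowed by the one for [Num.conj]. *)
Local Notation "x ^*" := (conjc x) : ring_scope.

(** * Roots of unity *)

(** In characteristic 0 the polynomial X^n - 1 is separable, so it has n distinct roots, and n
    distinct n-th roots of unity include a primitive one. *)
Lemma exists_prim_root (F : numClosedFieldType) n :
  (0 < n)%N -> exists z : F, n.-primitive_root z.
Proof.
move=> n0; have [r] := closed_field_poly_normal ('X^n - 1 : {poly F}).
rewrite (monicP _) ?monicXnsubC// scale1r => rE.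
have rn1 : all n.-unity_root r by apply/allP => z; rewrite -root_prod_XsubC -rE.
have sz_r : (n < (size r).+1)%N.
  by rewrite -(size_prod_XsubC r id) -rE size_XnsubC.
have [|z _ zP] := hasP (has_prim_root n0 rn1 _ sz_r); last by exists z.
by rewrite -separable_prod_XsubC -rE separable_Xn_sub_1// pnatr_eq0 -lt0n.
Qed.

Section RootsOfUnity.
Variables (R : realType) (N : nat) (z : R[i]).
Hypothesis N1 : (1 < N)%N.
Hypothesis hz : N.-primitive_root z.
Implicit Types (c d g : 'Z_N) (v : R[i]).

Lemma prim_expZD c d : z ^+ (c + d)%R = z ^+ c * z ^+ d.
Proof.
rewrite -exprD -(prim_expr_mod hz (c + d)%N).
by congr (_ ^+ (_ %% _)%N); exact: Zp_cast.
Qed.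

Lemma prim_expZ_inj c d : z ^+ c = z ^+ d -> c = d.
Proof.
have lt_N (a : 'Z_N) : (a < N)%N.
  by have := ltn_ord a; rewrite [X in (_ < X)%N](Zp_cast N1).
move=> /eqP; rewrite (eq_prim_root_expr hz) !modn_small// => /eqP.
exact: val_inj.
Qed.

Lemma unity_conjM (u : R[i]) n : (0 < n)%N -> u ^+ n = 1 -> u * u^* = 1.
Proof.
move=> n0 un; rewrite -sqr_normc; have -> : `|u| = 1; last by rewrite expr1n.
by apply/eqP; rewrite -(@pexpr_eq1 _ _ n)// -normrX un normr1.
Qed.

Lemma prim_expZK c : (z ^+ c)^* * z ^+ c = 1.
Proof.
rewrite mulrC (@unity_conjM _ N) ?(ltnW N1)//.
by rewrite -exprM mulnC exprM (prim_expr_order hz) expr1n.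
Qed.

Lemma conjcM (x y : R[i]) : (x * y)^* = x^* * y^*.
Proof. exact: rmorphM. Qed.

(* How strictly [z ^+ c] is the N-th root of unity nearest to the direction of
   [v]; it vanishes when another root is at least as near. *)
Definition near_weight c v : R :=
  \prod_(d | d != c)
    Num.max 0 (complex.Re (v * (z ^+ c)^*) - complex.Re (v * (z ^+ d)^*)).

Lemma near_weight_ge0 c v : 0 <= near_weight c v.
Proof. by apply: prodr_ge0 => d _; rewrite le_max lexx. Qed.

(** The factors that compare [c] with [d] in the two products are the positive parts of opposite
    numbers. *)
Lemma near_weight_ortho c d v :
  c != d -> near_weight c v * near_weight d v = 0.
Proof.
move=> cd; rewrite /near_weight (bigD1 d) 1?eq_sym//= [X in _ * X](bigD1 c)//=.
set x := complex.Re _; set y := complex.Re _.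
have [xy|yx] := leP x y.
  by rewrite (max_idPl _) ?subr_le0// mul0r mul0r.
by rewrite [X in _ * (X * _)](max_idPl _) ?subr_le0 1?ltW// mul0r mulr0.
Qed.

Lemma near_weight_rot c g v : near_weight (c + g) (z ^+ g * v) = near_weight c v.
Proof.
rewrite /near_weight (reindex_inj (addIr g)); apply: eq_big => d.
  by rewrite (inj_eq (addIr g)).
move=> _; congr (Num.max _ (complex.Re _ - complex.Re _)).
  rewrite prim_expZD conjcM -[RHS]mulr1 -(prim_expZK g); ring.
rewrite prim_expZD conjcM -[RHS]mulr1 -(prim_expZK g); ring.
Qed.

(** A root that maximizes the real part has weight 0, hence ties with another root; [v] then lies on
    the line bisecting the two, and [u] is their product. *)
Lemma near_weight_eq0 v : (forall c, near_weight c v = 0) ->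
  exists2 u, u ^+ N = 1 & v = v^* * u.
Proof.
move=> v0.
pose m c := complex.Re (v * (z ^+ c)^*).
case: (@Order.TotalTheory.arg_maxP _ _ _ (0 : 'Z_N) xpredT m isT) => c _ mc.
have /eqP := v0 c; rewrite prodf_seq_eq0 => /hasP[d _ /andP[dc]].
rewrite -/(m c) -/(m d) => md.
have {md} md : m c = m d.
  apply/eqP; rewrite eq_le [X in _ && X]mc// andbT leNgt -subr_gt0.
  by apply/negP => h; move: md; rewrite (max_idPr (ltW h)) gt_eqF.
exists (z ^+ c * z ^+ d).
  by rewrite exprMn -!exprM ![(_ * N)%N]mulnC !exprM (prim_expr_order hz) !expr1n mul1r.
have {}md : v * (z ^+ c)^* + v^* * z ^+ c = v * (z ^+ d)^* + v^* * z ^+ d.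
  have e a : v * a^* + v^* * a = 2 * (complex.Re (v * a^*))%:C.
    by rewrite -addcJ conjcM conjcK.
  by rewrite !e; congr (_ * _%:C).
have Kc := prim_expZK c; have Kd := prim_expZK d.
have cd : z ^+ d - z ^+ c != 0.
  by rewrite subr_eq0; apply: contra dc => /eqP/prim_expZ_inj ->.
apply: (mulIf cd); move: Kc Kd md; set a := z ^+ c; set b := z ^+ d.
set a' := a^*; set b' := b^*; set w := v^* => Kc Kd md.
have -> : v * (b - a) = v * a' * (a * b) - v * b' * (a * b)
    + v * b * (1 - a' * a) - v * a * (1 - b' * b) by ring.
rewrite Kc Kd subrr !mulr0 addr0 subr0 -mulrBl.
have -> : v * a' - v * b' = w * b - w * a.
  by apply/eqP; rewrite subr_eq -addrA addrCA addrC -subr_eq opprK md addrC; apply/eqP; ring.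
ring.
Qed.

(** The weights have disjoint supports, so at most one term survives: the value lies on the ray
    through the root nearest to [v], and it is 0 at ties. *)
Definition ray_retract v : R[i] := \sum_c (near_weight c v)%:C * z ^+ c.

Lemma ray_sum (f : 'Z_N -> R) c :
  (forall d, d != c -> f d = 0) -> \sum_d (f d)%:C * z ^+ d = (f c)%:C * z ^+ c.
Proof.
move=> h; rewrite (bigD1 c)//= big1 ?addr0// => d dc.
by rewrite h// mul0r.
Qed.

Lemma ray_sumP (f : 'Z_N -> R) :
  (forall c, 0 <= f c) -> (forall c d, c != d -> f c * f d = 0) ->
  0 <= (\sum_d (f d)%:C * z ^+ d) ^+ N /\
  (\sum_d (f d)%:C * z ^+ d = 0 -> forall c, f c = 0).
Proof.
move=> f0 fo.
have h c : f c != 0 -> \sum_d (f d)%:C * z ^+ d = (f c)%:C * z ^+ c.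
  move=> fc; apply: ray_sum => d dc; apply/eqP.
  by have /eqP := fo _ _ dc; rewrite mulf_eq0 (negbTE fc) orbF.
have z0 : z != 0 by rewrite (prim_root_eq0 hz) -lt0n (ltnW N1).
have [c fc|f00] := pickP (fun c => f c != 0).
  split; first rewrite (h _ fc) exprMn -exprM mulnC exprM (prim_expr_order hz).
    by rewrite expr1n mulr1 exprn_ge0// ler0c.
  move=> s0 d; apply: contraTeq isT => fd; have := h _ fd; rewrite s0 => /esym/eqP.
  rewrite mulf_eq0 expf_eq0 (negbTE z0) andbF orbF => /eqP[/eqP].
  by rewrite (negbTE fd).
have f_0 c : f c = 0 by apply/eqP/negbNE; rewrite f00.
split=> //; rewrite big1 ?expr0n ?exprn_ge0// => c _; by rewrite f_0 mul0r.
Qed.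

Lemma ray_retractP v :
  0 <= ray_retract v ^+ N /\ (ray_retract v = 0 -> forall c, near_weight c v = 0).
Proof.
apply: ray_sumP => [c|c d]; [exact: near_weight_ge0|exact: near_weight_ortho].
Qed.

Lemma ray_retract_rot g v : ray_retract (z ^+ g * v) = z ^+ g * ray_retract v.
Proof.
rewrite /ray_retract (reindex_inj (addIr g)) mulr_sumr; apply: eq_bigr => c _.
by rewrite near_weight_rot prim_expZD; ring.
Qed.

(** Divided by its modulus, [v] is a root [z ^+ c]. Its quotient [w] by any other root has modulus 1
    and differs from 1, so the real part of [w] is below 1 and every factor of the weight is
    positive. *)
Lemma near_weight_ray v : 0 <= v ^+ N -> v != 0 -> exists c, near_weight c v != 0.
Proof.
move=> vN v0.
have nv : `|v| != 0 by rewrite normr_eq0.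
have : (v / `|v|) ^+ N = 1.
  by rewrite expr_div_n -normrX ger0_norm// divff// expf_eq0 (negbTE v0) andbF.
move=> /(prim_rootP hz)[i iE].
pose c : 'Z_N := inZp i.
have ci : (c : nat) = i by rewrite /c /= modn_small// Zp_cast.
exists c; apply/prodf_neq0 => d dc.
rewrite gt_eqF// lt_max; apply/orP; right; rewrite subr_gt0.
have vE : v = `|v| * z ^+ c by rewrite ci -iE mulrCA divff// mulr1.
have KcC : z ^+ c * (z ^+ c)^* = 1 by rewrite mulrC prim_expZK.
have -> : v * (z ^+ c)^* = (normc v)%:C.
  by rewrite {1}vE -mulrA KcC mulr1.
have -> : v * (z ^+ d)^* = (normc v)%:C * (z ^+ c * (z ^+ d)^*).
  by rewrite {1}vE mulrA.
set w := z ^+ c * _.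
have wn : normc w = 1.
  have /(congr1 (@complex.Re R)) : `|w| = 1.
    apply/eqP; rewrite -(@pexpr_eq1 _ _ 2)// sqr_normc /w conjcM conjcK.
    by rewrite mulrACA KcC prim_expZK mulr1.
  by [].
have w1 : w != 1.
  apply: contra dc => /eqP w1; apply/eqP/prim_expZ_inj.
  by rewrite -[LHS]mul1r -w1 /w -mulrA prim_expZK mulr1.
have np : 0 < normc v.
  by rewrite lt0r normc_ge0 andbT; apply: contra v0 => /eqP/eq0_normc ->.
suff : complex.Re w < 1.
  by move=> h; case: {w1 wn} w h => a b /= h; rewrite mul0r subr0 gtr_pMr.
rewrite lt_neqAle -{2}wn (le_trans (ler_norm _) (Re_le_normc _)) andbT.
apply: contra w1; case: w wn => a b /= wn /eqP a1; move: wn; rewrite a1.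
move=> /(congr1 (fun x => x ^+ 2)); rewrite sqr_sqrtr; last by rewrite addr_ge0 ?sqr_ge0.
move=> /eqP; rewrite !expr1n -subr_eq0 [1 + _]addrC addrK expf_eq0/= => /eqP ->.
by [].
Qed.

End RootsOfUnity.

(** * Continuity and residues *)

Section Continuity.
Variables (R : realType) (T : topologicalType).

Lemma Re_continuous (f : T -> R[i]) :
  continuous f -> continuous (fun x => complex.Re (f x)).
Proof.
move=> /continuous_normcP cf x; apply/cvgrPdist_lt => e /(cf x).
by apply: filterS => y; apply: le_lt_trans; rewrite -raddfB Re_le_normc.
Qed.

Lemma real_complex_continuous (f : T -> R) :
  continuous f -> continuous (fun x => (f x)%:C).
Proof.
move=> cf; apply/continuous_normcP => x e e0.
have /cvgrPdist_lt/(_ e e0) := cf x; apply: filterS => y.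
by rewrite -rmorphB /= expr0n addr0 sqrtr_sqr.
Qed.

Lemma max0_continuous (f : T -> R) :
  continuous f -> continuous (fun x => Num.max 0 (f x)).
Proof.
move=> cf x; apply: (@continuous_max R _ (fun=> 0) f x); last exact: cf.
exact: cvg_cst.
Qed.

Lemma near_weight_continuous N (z : R[i]) (c : 'Z_N) (f : T -> R[i]) :
  continuous f -> continuous (fun x => near_weight z c (f x)).
Proof.
move=> cf; apply: continuous_big => [|d _]; first exact: mul_continuous.
have cRe (w : R[i]) : continuous (fun x => complex.Re (f x * w)).
  by apply: Re_continuous => x; apply: cvgM; [exact: cf|exact: cvg_cst].
by apply: max0_continuous => x; apply: cvgB; exact: cRe.
Qed.

Lemma ray_sum_continuous N (z : R[i]) (f : 'Z_N -> T -> R) :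
  (forall c, continuous (f c)) ->
  continuous (fun x => \sum_c (f c x)%:C * z ^+ c).
Proof.
move=> cf x; apply: cvg_big => [|c _]; first exact: add_continuous.
apply: cvgM; last exact: cvg_cst.
exact: (real_complex_continuous (cf c)).
Qed.

Lemma ray_retract_continuous N (z : R[i]) (f : T -> R[i]) :
  continuous f -> continuous (fun x => @ray_retract R N z (f x)).
Proof.
by move=> cf; apply: ray_sum_continuous => c; exact: near_weight_continuous.
Qed.

(* [CfunD] and its companions are stated with the coercion [Continuous.sort], so
   they do not rewrite values written with [Cfun_fun]. *)
Lemma Cfun_addE (f g : Cfun R T) x : Cfun_fun (f + g) x = f x + g x. Proof. by []. Qed.
Lemma Cfun_subE (f g : Cfun R T) x : Cfun_fun (f - g) x = f x - g x. Proof. by []. Qed.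
Lemma Cfun_mulE (f g : Cfun R T) x : Cfun_fun (f * g) x = f x * g x. Proof. by []. Qed.

Lemma Cfun_expE (f : Cfun R T) n x : Cfun_fun (f ^+ n) x = f x ^+ n.
Proof. by elim: n => [|n IH]; rewrite ?expr0// !exprS Cfun_mulE IH. Qed.

End Continuity.

Section Residues.
Variable p : nat.
Hypothesis p1 : (1 < p)%N.
Implicit Types x y g : padicInt p.

Lemma expS_gt1 i : (1 < p ^ i.+1)%N.
Proof. by rewrite -{1}(exp1n i.+1) ltn_exp2r. Qed.

Lemma residue_mod x i d : residue x i = (residue x (i + d) %% p ^ i.+1)%N :> nat.
Proof.
elim: d => [|d IH]; first by rewrite addn0 modn_small// -[ltnRHS]Zp_cast ?expS_gt1.
have e a : (a %% (Zp_trunc (p ^ (i + d).+1)).+2 = a %% p ^ (i + d).+1)%N.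
  by rewrite Zp_cast ?expS_gt1.
rewrite IH addnS -(residueS x (i + d)%N) /= e.
by rewrite modn_dvdm// dvdn_exp2l// ltnS leq_addr.
Qed.

Lemma residue_eq_le x y i j :
  (i <= j)%N -> residue x j = residue y j -> residue x i = residue y i.
Proof.
move=> /subnKC <- xy; apply: val_inj => /=.
by rewrite (residue_mod x i (j - i)) (residue_mod y i (j - i)) xy.
Qed.

Lemma residueD x y i : residue (x + y) i = residue x i + residue y i.
Proof. by []. Qed.
Lemma residueN x i : residue (- x) i = - residue x i. Proof. by []. Qed.
Lemma residueB x y i : residue (x - y) i = residue x i - residue y i.
Proof. by []. Qed.

Fact padic_natS n i : inZp (inZp n : 'Z_(p ^ i.+2)) = inZp n :> 'Z_(p ^ i.+1).
Proof. by apply: val_inj; rewrite /= modn_dvdm ?Zp_pow_dvd. Qed.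

(** Applied to a residue [c], this picks one element of the coset of p^(i+1) Z_p over [c]; the
    choice is not additive in [c]. *)
Definition padic_nat n : padicInt p := PadicInt (padic_natS n).

Lemma residue_padic_nat i (c : 'Z_(p ^ i.+1)) : residue (padic_nat c) i = c.
Proof. exact: valZpK. Qed.

Lemma padic_continuous_ball (P : set (padicInt p)) g :
  nbhs g P -> exists i, forall h, residue h i = residue g i -> P h.
Proof.
pose F : set_system (padicInt p) := [set A |
  exists i, forall h, residue h i = residue g i -> A h].
have FF : Filter F.
  split=> [|A B [i Ai] [j Bj]|A B AB [i Ai]]; first by exists 0%N.
    by exists (maxn i j) => h hE; split; [apply: Ai|apply: Bj];
      apply: residue_eq_le hE; rewrite ?leq_maxl ?leq_maxr.
  by exists i => h /Ai/AB.
have : F --> g by apply: cvg_padic => i; exists i.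
by apply.
Qed.

End Residues.

(** * Halving the level *)

Section ComplexLemmas.
Variable R : realType.
Implicit Types a b t u v : R[i].

Lemma conjcX u n : (u ^+ n)^* = u^* ^+ n.
Proof. exact: rmorphXn. Qed.

(* The first hypothesis says that [t ^+ q] lies in [0, oo), whereas the two
   equations force [t ^+ q = - `|a| ^+ (2 * q * q.-1)]. *)
Lemma common_zero_eq0 a b t q : (1 < q)%N -> 0 <= t ^+ q ->
  a ^+ q.-1 * b - t = 0 -> b ^+ q + a^* ^+ (q * q.-1) = 0 ->
  [/\ a = 0, b = 0 & t = 0].
Proof.
move=> q1 t0 /eqP; rewrite subr_eq0 => /eqP tE /eqP; rewrite addr_eq0 => /eqP bE.
have q0 : (0 < q)%N by exact: ltnW.
have n0 : (0 < q * q.-1)%N by rewrite muln_gt0 q0 -ltnS prednK.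
have tqE : t ^+ q = - (`|a| ^+ 2) ^+ (q * q.-1).
  rewrite sqr_normc -tE exprMn bE exprMn mulrN; congr (- (_ * _)).
  by rewrite -exprM mulnC.
have a0 : a = 0.
  apply/eqP; apply: contraTT t0 => a0; rewrite tqE oppr_ge0 lt_geF//.
  by rewrite !exprn_gt0// normr_gt0.
move/eqP: bE; rewrite a0 conjc0 expr0n gtn_eqF// oppr0 expf_eq0 => /andP[_ /eqP b0].
by rewrite -tE b0 mulr0.
Qed.

(** This merges two ray coordinates into one complex number. They cannot cancel: [u = - (th * v)]
    makes the square of [u ^+ n] equal to minus that of [v ^+ n]. *)
Lemma ray_comb_eq0 (th u v : R[i]) n : (0 < n)%N -> th ^+ n = 'i ->
  0 <= u ^+ n -> 0 <= v ^+ n -> u + th * v = 0 -> u = 0 /\ v = 0.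
Proof.
move=> n0 thn u0 v0 /eqP; rewrite addr_eq0 => /eqP uE.
have vn0 : v = 0.
  apply/eqP; apply: contraTT isT => v0'.
  have vn : 0 < v ^+ n by rewrite lt_def v0 expf_neq0.
  have : 0 <= (u ^+ n) ^+ 2 by rewrite exprn_ge0.
  have -> : (u ^+ n) ^+ 2 = - (v ^+ n) ^+ 2.
    rewrite uE exprNn [(th * v) ^+ n]exprMn thn exprMn sqrr_sign mul1r.
    by rewrite exprMn sqr_i mulN1r.
  by rewrite oppr_ge0 lt_geF// exprn_gt0.
by rewrite uE vn0 mulr0 oppr0.
Qed.

(** A vanishing retraction means a tie, so [v ^+ N] and the N-th power of [th * v], which is i times
    the former, are both real. *)
Lemma ray_retract_rotated_eq0 N (z th v : R[i]) : (1 < N)%N ->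
  N.-primitive_root z -> th ^+ N = 'i ->
  @ray_retract R N z v = 0 -> @ray_retract R N z (th * v) = 0 -> v = 0.
Proof.
move=> N1 hz thN r0 rth0.
have h w : @ray_retract R N z w = 0 -> w ^+ N = (w ^+ N)^*.
  move=> /((ray_retractP N1 hz _).2)/(near_weight_eq0 N1 hz)[u uN {1}->].
  by rewrite exprMn uN mulr1 conjcX.
have := h _ rth0; rewrite exprMn thN conjcM -(h _ r0) => /eqP.
rewrite -subr_eq0 -mulrBl mulf_eq0 expf_eq0 => /orP[|/andP[_ /eqP//]].
rewrite eq_complex /= !subr0 => /andP[_]; rewrite opprK -mulr2n mulrn_eq0.
by rewrite oner_eq0.
Qed.

End ComplexLemmas.

Section Rays.
Variables (R : realType) (p : nat) (X : topologicalType).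
Variable alpha : space_action (padicInt p) X.
Hypothesis p1 : (1 < p)%N.
Implicit Types (g : padicInt p) (s : Cfun R X).

Definition twisted i (z : R[i]) (s : Cfun R X) :=
  forall g x, s (alpha g x) = z ^+ residue g i * s x.

Definition ray_section i (z : R[i]) (s : Cfun R X) :=
  twisted i z s /\ forall x, 0 <= s x ^+ (p ^ i.+1).

(* Up to normalization, an equivariant map from X to the join of [d] copies of
   Z/p^(i+1), each copy being realized as the rays in C through the roots of
   unity. *)
Definition has_rays d i := exists z (s : nat -> Cfun R X),
  [/\ (p ^ i.+1).-primitive_root z, forall j, ray_section i z (s j) &
      forall x, exists2 j, (j < d)%N & s j x != 0].

Lemma has_rays_le d e i : (d <= e)%N -> has_rays d i -> has_rays e i.
Proof.
move=> de [z [s [zP sP s0]]]; exists z, s; split=> // x.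
by have [j jd sj] := s0 x; exists j => //; exact: leq_trans jd de.
Qed.

Definition retract_section i (z : R[i]) (s : Cfun R X) : Cfun R X :=
  mkCfun (@ray_retract_continuous R X (p ^ i.+1) z s (@Cfun_continuous R X s)).

Lemma retract_section_ray i z s : (p ^ i.+1).-primitive_root z ->
  twisted i z s -> ray_section i z (retract_section i z s).
Proof.
move=> zP sP; split=> [g x|x].
  change (@ray_retract R (p ^ i.+1) z (s (alpha g x)) =
    z ^+ residue g i * @ray_retract R (p ^ i.+1) z (s x)).
  by rewrite sP (ray_retract_rot (expS_gt1 p1 i) zP).
exact: (ray_retractP (expS_gt1 p1 i) zP _).1.
Qed.

Definition cst_section (t : R[i]) : Cfun R X := mkCfun (@cst_cts R X t).

Lemma twisted_cstM i z t s : twisted i z s -> twisted i z (cst_section t * s).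
Proof. by move=> sP g x; rewrite !Cfun_mulE sP mulrCA. Qed.

Lemma twistedD i z s t : twisted i z s -> twisted i z t -> twisted i z (s + t).
Proof. by move=> sP tP g x; rewrite !Cfun_addE sP tP mulrDr. Qed.

Section Halving.
Variables (k : nat) (z : R[i]).
Let q := (p ^ k.+1)%N.
Hypothesis zP : (p ^ k.*2.+2).-primitive_root z.

(** Level [i] has modulus p^(i+1), so it is level 2k+1, not 2k, that has modulus q^2. *)
Let Mq : (p ^ k.*2.+2 = q * q)%N.
Proof. by rewrite -expnD addSn addnS -addnn. Qed.

Lemma root_halving : q.-primitive_root (z ^+ q).
Proof.
have q0 : (0 < q)%N by exact: ltnW (expS_gt1 p1 k).
have := dvdn_prim_root zP (m := q); rewrite Mq dvdn_mulr// mulnK//.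
by apply.
Qed.

(** The residue at level [k] is the one at level 2k+1 reduced modulo q, and the reduction does not
    affect powers of [z ^+ q], which has order q. *)
Lemma character_halving g :
  (z ^+ q) ^+ residue g k = (z ^+ residue g k.*2.+1) ^+ q.
Proof.
rewrite (residue_mod p1 g k k.+1) addnS addnn -!exprM muln_modr -/q -Mq.
by rewrite (prim_expr_mod zP) mulnC.
Qed.

Lemma ray_section_exp s :
  ray_section k.*2.+1 z s -> ray_section k (z ^+ q) (s ^+ q).
Proof.
move=> [sP s0]; split=> [g x|x]; last by rewrite Cfun_expE -exprM -Mq.
by rewrite !Cfun_expE sP exprMn character_halving.
Qed.

Variables a b t : Cfun R X.
Hypotheses (aP : twisted k.*2.+1 z a) (bP : twisted k.*2.+1 z b).

(** The common factor [c] of [a] and [b] enters q - 1 times and once, hence as [c ^+ q], the factor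
    of level [k]. *)
Lemma twisted_first : twisted k (z ^+ q) t ->
  twisted k (z ^+ q) (a ^+ q.-1 * b - t).
Proof.
move=> tP g x; rewrite !Cfun_subE !Cfun_mulE !Cfun_expE aP bP tP character_halving.
have q0 : (0 < q)%N by exact: ltnW (expS_gt1 p1 k).
set c := z ^+ _.
have -> : c ^+ q = c * c ^+ q.-1 by rewrite -exprS prednK.
rewrite exprMn; ring.
Qed.

(** Conjugation inverts the factor [c], and c^(-q(q-1)) = c^q because c^(q^2) = 1. *)
Lemma twisted_second :
  twisted k (z ^+ q) (b ^+ q + Cfun_star a ^+ (q * q.-1)).
Proof.
move=> g x; rewrite !Cfun_addE !Cfun_expE.
have sE y : Cfun_fun (Cfun_star a) y = (a y)^* by [].
rewrite !sE aP bP character_halving conjcM !exprMn mulrDr; congr (_ + _ * _).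
set c := z ^+ _.
have cM : c ^+ (q * q) = 1.
  by rewrite -Mq /c -exprM mulnC exprM (prim_expr_order zP) expr1n.
have q0 : (0 < q)%N by exact: ltnW (expS_gt1 p1 k).
have nq : c ^+ (q * q.-1) * c ^+ q = 1 by rewrite -exprD -mulnSr prednK.
rewrite -[LHS]mulr1 -nq mulrA -exprMn [c^* * c]mulrC (unity_conjM _ cM).
  by rewrite expr1n mul1r.
by rewrite muln_gt0 q0.
Qed.

End Halving.

Lemma has_rays_halving d k : has_rays (5 + d) k.*2.+1 -> has_rays (4 + d) k.
Proof.
move=> [z [s [zP sP s0]]].
set q := (p ^ k.+1)%N.
have q1 : (1 < q)%N by exact: expS_gt1.
have M1 : (1 < p ^ k.*2.+2)%N by exact: expS_gt1.
(* [th] prevents cancellation between rays of order q^2; [et] excludes simultaneous ties for the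
   retractions onto rays of order q. *)
pose th : R[i] := (p ^ k.*2.+2).-root%R 'i.
have thM : th ^+ (p ^ k.*2.+2) = 'i by rewrite rootCK// ltnW.
pose et : R[i] := q.-root%R 'i.
have etq : et ^+ q = 'i by rewrite rootCK// ltnW.
pose a : Cfun R X := s 0%N + cst_section th * s 1%N.
pose b : Cfun R X := s 2%N + cst_section th * s 3%N.
have aP : twisted k.*2.+1 z a.
  by apply: twistedD; [|apply: twisted_cstM]; exact: (sP _).1.
have bP : twisted k.*2.+1 z b.
  by apply: twistedD; [|apply: twisted_cstM]; exact: (sP _).1.
have eP j := ray_section_exp zP (sP j).
pose w := z ^+ q; have wP : q.-primitive_root w by exact: root_halving zP.
pose P : Cfun R X := a ^+ q.-1 * b - s 4%N ^+ q.
pose Q : Cfun R X := b ^+ q + Cfun_star a ^+ (q * q.-1).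
have PP : twisted k w P := twisted_first zP aP bP (eP 4%N).1.
have QP : twisted k w Q := twisted_second zP aP bP.
pose r := retract_section k w.
(* [P] and [Q] yield two coordinates each. The old coordinate 4 is absorbed into [P], and the later
   ones are shifted down by one. *)
exists w, (fun j => match j with
  | 0 => r P | 1 => r (cst_section et * P)
  | 2 => r Q | 3 => r (cst_section et * Q)
  | j.+4 => s j.+4.+1 ^+ q end); split=> //.
  case=> [|[|[|[|j]]]] //; apply: retract_section_ray => //; exact: twisted_cstM.
have zero f x : r f x = 0 -> r (cst_section et * f) x = 0 -> f x = 0.
  exact: ray_retract_rotated_eq0.
move=> x.
have [P0|P0] := eqVneq (r P x) 0; last by exists 0%N.
have [P1|P1] := eqVneq (r (cst_section et * P) x) 0; last by exists 1%N.
have [Q0|Q0] := eqVneq (r Q x) 0; last by exists 2%N.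
have [Q1|Q1] := eqVneq (r (cst_section et * Q) x) 0; last by exists 3%N.
have Px := zero _ _ P0 P1; have Qx := zero _ _ Q0 Q1.
have [|||ax bx tx] := @common_zero_eq0 R (a x) (b x) (s 4%N x ^+ q) q q1.
- by rewrite -Cfun_expE; exact: (eP 4%N).2.
- by rewrite -Px /P Cfun_subE Cfun_mulE !Cfun_expE.
- by rewrite -Qx [RHS]Cfun_addE !Cfun_expE.
have [s00 s10] := ray_comb_eq0 (ltnW M1) thM ((sP 0%N).2 x) ((sP 1%N).2 x) ax.
have [s20 s30] := ray_comb_eq0 (ltnW M1) thM ((sP 2%N).2 x) ((sP 3%N).2 x) bx.
have [j jd sj] := s0 x.
case: j jd sj => [|[|[|[|[|j]]]]] jd sj.
- by rewrite s00 eqxx in sj.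
- by rewrite s10 eqxx in sj.
- by rewrite s20 eqxx in sj.
- by rewrite s30 eqxx in sj.
- by move/eqP: tx; rewrite expf_eq0 (negbTE sj) andbF.
- by exists j.+4 => //; rewrite Cfun_expE expf_neq0.
Qed.

(** A halving removes one coordinate at level [k] but consumes level 2k+1, so the induction carries
    all levels at once. *)
Lemma has_rays4 d : (forall i, has_rays d i) -> forall i, has_rays 4 i.
Proof.
move=> h; have {}h : forall i, has_rays (4 + d) i.
  by move=> i; apply: has_rays_le (h i); exact: leq_addl.
elim: d h => // d IH h; apply: IH => i.
by apply: has_rays_halving; exact: h.
Qed.

End Rays.

(** * Order zero maps from weights *)

Lemma normc_le_Cfun_cnorm (R : realType) (X : compactType) (f : Cfun R X) x :
  normc (f x) <= cnorm f.
Proof. exact: Cfun_norm_ub. Qed.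

Lemma Cfun_cnorm_le (R : realType) (X : compactType) (f : Cfun R X) M :
  0 <= M -> (forall x, normc (f x) <= M) -> cnorm f <= M.
Proof. exact: Cfun_norm_le. Qed.

Lemma normc_real_ge0 (R : realType) (t : R) : 0 <= t -> normc t%:C = t.
Proof. by move=> t0; rewrite /normc /= expr0n addr0 sqrtr_sqr ger0_norm. Qed.

Lemma normc_sum (R : realType) (I : finType) (f : I -> R[i]) :
  normc (\sum_c f c) <= \sum_c normc (f c).
Proof.
apply: (big_ind2 (fun x y => normc x <= y)) => [|x1 y1 x2 y2 h1 h2|//].
  by rewrite normc0.
by rewrite (le_trans (le_normcD _ _))// lerD.
Qed.

Lemma ortho_sumM (K : pzRingType) (I : finType) (a b : I -> K) :
  (forall c d, c != d -> a c * b d = 0) ->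
  (\sum_c a c) * (\sum_c b c) = \sum_c a c * b c.
Proof.
move=> ab; rewrite mulr_suml; apply: eq_bigr => c _.
rewrite mulr_sumr (bigD1 c)//= big1 ?addr0// => d dc.
by rewrite ab// eq_sym.
Qed.

Section OrderZeroMaps.
Variables (R : realType) (p : nat) (X : compactType).
Hypothesis p1 : (1 < p)%N.
Notation G := (padicInt p).
Variable w : forall n, 'Z_(p ^ n.+1) -> X -> R.
Hypothesis w_cts : forall n c, continuous (@w n c).
Hypothesis w_ortho : forall n c d x, c != d -> @w n c x * @w n d x = 0.
Hypothesis w_le1 : forall n x, \sum_c (@w n c x) ^+ 2 <= 1.
Implicit Types F H : Cfun R G.

Fact root_map_cts n F : continuous (fun x =>
  \sum_(c : 'Z_(p ^ n.+1)) F (padic_nat p c) * (w c x)%:C).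
Proof.
move=> x; apply: cvg_big => [|c _]; first exact: add_continuous.
by apply: cvgM; [exact: cvg_cst|apply: real_complex_continuous; exact: w_cts].
Qed.

Fact level_map_cts n F : continuous (fun x =>
  \sum_(c : 'Z_(p ^ n.+1)) F (padic_nat p c) * (w c x ^+ 2)%:C).
Proof.
move=> x; apply: cvg_big => [|c _]; first exact: add_continuous.
apply: cvgM; first exact: cvg_cst.
apply: (@real_complex_continuous _ _ (fun x => w c x ^+ 2)) => y.
by apply: cvgM; exact: w_cts.
Qed.

(** [root_map] carries the weights whose squares enter [level_map]; it provides the square roots
    that witness complete positivity. *)
Definition root_map n F := mkCfun (@root_map_cts n F).
Definition level_map n F := mkCfun (@level_map_cts n F).

Lemma root_mapE n F x :
  root_map n F x = \sum_(c : 'Z_(p ^ n.+1)) F (padic_nat p c) * (@w n c x)%:C.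
Proof. by []. Qed.

Lemma level_mapE n F x :
  level_map n F x = \sum_(c : 'Z_(p ^ n.+1)) F (padic_nat p c) * (@w n c x ^+ 2)%:C.
Proof. by []. Qed.

Lemma level_mapM n F H :
  level_map n (star F * H) = star (root_map n F) * root_map n H.
Proof.
apply: CfunP => x.
have -> : Cfun_fun (star (root_map n F) * root_map n H) x =
  (root_map n F x)^* * root_map n H x by [].
rewrite !root_mapE level_mapE rmorph_sum /= ortho_sumM => [|c d cd].
  apply: eq_bigr => c _; set g := padic_nat p c.
  change ((F g)^* * H g * (w c x ^+ 2)%:C
    = (F g * (w c x)%:C)^* * (H g * (w c x)%:C)).
  by rewrite conjcM conjc_real rmorphXn /= expr2; ring.
rewrite conjcM conjc_real mulrACA -rmorphM /= w_ortho//.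
by rewrite mulr0.
Qed.

Lemma level_map_norm n e (a : 'Z_(p ^ n.+1) -> R[i]) x : 0 <= e ->
  (forall c, normc (a c) <= e) ->
  normc (\sum_c a c * (w c x ^+ 2)%:C) <= e.
Proof.
move=> e0 ae; apply: le_trans (normc_sum _) _.
apply: (@le_trans _ _ (\sum_c e * @w n c x ^+ 2)).
  apply: ler_sum => c _; rewrite normcM normc_real_ge0 ?sqr_ge0//.
  by rewrite ler_wpM2r ?sqr_ge0.
by rewrite -mulr_sumr ler_piMr.
Qed.

Lemma level_map_contractive n F : cnorm (level_map n F) <= cnorm F.
Proof.
apply: Cfun_cnorm_le => [|x]; first exact: cnorm_ge0.
apply: level_map_norm => // [|c]; first exact: cnorm_ge0.
exact: normc_le_Cfun_cnorm.
Qed.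

(** The C*-identity reduces this to contractivity of [level_map] at [star F * F]. *)
Lemma root_map_contractive n F : cnorm (root_map n F) <= cnorm F.
Proof.
rewrite -ler_sqr ?nnegrE ?cnorm_ge0// -!cnorm_starM -level_mapM.
exact: level_map_contractive.
Qed.

Fact root_map_bounded F : exists M, forall n, cnorm (root_map n F) <= M.
Proof. by exists (cnorm F) => n; exact: root_map_contractive. Qed.

Fact level_map_bounded F : exists M, forall n, cnorm (level_map n F) <= M.
Proof. by exists (cnorm F) => n; exact: level_map_contractive. Qed.

Definition root_seq F : linf (Cfun R X) := mklinf (root_map_bounded F).
Definition level_seq F : linf (Cfun R X) := mklinf (level_map_bounded F).

Fact ainf_Cfun_central (a : ainf (Cfun R X)) : a \in @central_seq R (Cfun R X).
Proof.
apply/asboolP => f; elim/ainfW: a => u; rewrite -!pi_ainfM; congr pi_ainf.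
by apply: linfP => n; rewrite !linfM; apply: CfunP => x; exact: mulrC.
Qed.

Definition limit_map F : commutant (Cfun R X) :=
  Commutant (ainf_Cfun_central (pi_ainf (level_seq F))).

Definition limit_root F : commutant (Cfun R X) :=
  Commutant (ainf_Cfun_central (pi_ainf (root_seq F))).

Lemma level_mapD n F H : level_map n (F + H) = level_map n F + level_map n H.
Proof.
apply: CfunP => x; rewrite Cfun_addE !level_mapE -big_split.
by apply: eq_bigr => c _; exact: mulrDl.
Qed.

Lemma limit_mapD F H : limit_map (F + H) = limit_map F + limit_map H.
Proof.
apply: val_inj; change (pi_ainf (level_seq (F + H)) =
  pi_ainf (level_seq F) + pi_ainf (level_seq H)).
by rewrite -pi_ainfD; congr pi_ainf; apply: linfP => n; exact: level_mapD.
Qed.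

Lemma limit_map_scale t F : limit_map (Defs.cscale t F) = Defs.cscale t (limit_map F).
Proof.
apply: val_inj; change (pi_ainf (level_seq (Defs.cscale t F)) =
  ainf_scale t (pi_ainf (level_seq F))).
rewrite pi_scale; congr pi_ainf; apply: linfP => n; apply: CfunP => x.
change (level_map n (Defs.cscale t F) x = t * level_map n F x).
by rewrite !level_mapE mulr_sumr; apply: eq_bigr => c _; rewrite mulrA.
Qed.

Lemma limit_mapM F H :
  limit_map (star F * H) = star (limit_root F) * limit_root H.
Proof.
apply: val_inj; change (pi_ainf (level_seq (star F * H)) =
  ainf_star (pi_ainf (root_seq F)) * pi_ainf (root_seq H)).
rewrite pi_star -pi_ainfM; congr pi_ainf; apply: linfP => n.
exact: level_mapM.
Qed.

Lemma limit_map0 : limit_map 0 = 0.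
Proof. by apply: (@addrI _ (limit_map 0)); rewrite -limit_mapD !addr0. Qed.

Lemma limit_map_cp : completely_positive limit_map.
Proof.
move=> n M [N ->]; exists (map_mx limit_root N).
apply/matrixP => i j; rewrite !mxE.
rewrite (big_morph limit_map limit_mapD limit_map0).
by apply: eq_bigr => k _; rewrite !mxE limit_mapM.
Qed.

Lemma limit_map_order_zero : order_zero limit_map.
Proof.
move=> F H FH0; apply: val_inj.
change (pi_ainf (level_seq F) * pi_ainf (level_seq H) = 0).
rewrite -pi_ainfM -pi_ainf0; congr pi_ainf; apply: linfP => n.
apply: CfunP => x; change (level_map n F x * level_map n H x = 0).
rewrite !level_mapE ortho_sumM => [|c d cd].
  rewrite big1// => c _; rewrite mulrACA.
  by rewrite -[F _ * H _]/(Cfun_fun (F * H) _) FH0 mul0r.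
by rewrite mulrACA -rmorphM /= -exprMn w_ortho// expr0n mulr0.
Qed.

Lemma limit_map_contractive : contractive limit_map.
Proof.
move=> F; apply: (le_trans (ainf_norm_le (level_seq F))).
apply: linf_norm_le => [|n]; first exact: cnorm_ge0.
exact: level_map_contractive.
Qed.

Lemma limit_map_cpc_order_zero : cpc_order_zero limit_map.
Proof.
split; last exact: limit_map_order_zero.
- by split; [exact: limit_mapD|exact: limit_map_scale].
- exact: limit_map_cp.
- exact: limit_map_contractive.
Qed.

(** Norm continuity at 0 of the translation action amounts to uniform continuity of [F]. *)
Lemma Cfun_padic_unif F (e : R) : 0 < e ->
  exists i, forall x y, residue x i = residue y i -> normc (F x - F y) < e.
Proof.
move=> e0; have := pullback_continuous (translation G) 0 F.
move=> /cvgrPdist_lt/(_ e e0)/(padic_continuous_ball p1)[i hi]; exists i => x y xy.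
have := hi (x - y); rewrite residueB xy subrr => /(_ erefl).
rewrite sub0r normrN ger0_norm ?cnorm_ge0//; apply: le_lt_trans.
pose f : Cfun R G := pullback (translation G) (x - y) F - pullback (translation G) 0 F.
have fE : f x = F y - F x.
  have -> : f x = F (- (x - y) + x) - F (- 0 + x) by [].
  by rewrite opprB subrK oppr0 add0r.
by rewrite -normcN opprB -fE; exact: normc_le_Cfun_cnorm f x.
Qed.

(** At level [n] the two sides evaluate [F] at p-adic integers with equal residue, so their
    difference tends to 0 with [n] and vanishes in the sequence algebra. *)
Lemma limit_map_equivariant (alpha : space_action G X) :
  (forall n c g x, @w n c (alpha g x) = w (c - residue g n) x) ->
  equivariant (induced_action R alpha) limit_map.
Proof.
move=> w_equiv g F.
change (pi_ainf (level_seq (induced_action R (translation G) g F)) =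
  ainf_act (induced_action R alpha) g (pi_ainf (level_seq F))).
rewrite ainf_act_pi; apply/pi_ainfP/c0_seqP => e e0.
have e2 : 0 < e / 2 by rewrite divr_gt0.
have [i hi] := Cfun_padic_unif F e2; exists i => n ni.
apply: (@le_lt_trans _ _ (e / 2)); last by rewrite ltr_pdivrMr// ltr_pMr// ltr1n.
apply: Cfun_cnorm_le => [|x]; first exact: ltW.
set D := (D in Cfun_fun D x).
pose a (c : 'Z_(p ^ n.+1)) : R[i] :=
  F (- g + padic_nat p c) - F (padic_nat p (c - residue g n)%R).
have -> : Cfun_fun D x = \sum_c a c * (w c x ^+ 2)%:C.
  transitivity (
    \sum_(c : 'Z_(p ^ n.+1)) F (- g + padic_nat p c) * (w c x ^+ 2)%:C -
    \sum_(c : 'Z_(p ^ n.+1)) F (padic_nat p c) * (w c (alpha (- g) x) ^+ 2)%:C).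
    by [].
  rewrite [X in _ - X](reindex_inj (addIr (- residue g n))) -sumrB.
  by apply: eq_bigr => c _; rewrite w_equiv residueN opprK subrK -mulrBl.
apply: level_map_norm => [|c]; first exact: ltW.
rewrite /a; apply/ltW/hi/(residue_eq_le p1 ni).
by rewrite residueD residueN !residue_padic_nat addrC.
Qed.

End OrderZeroMaps.

(** * From ray sections to Rokhlin maps *)

Section RaysToRokhlin.
Variables (R : realType) (p : nat) (X : compactType).
Variable alpha : space_action (padicInt p) X.
Hypothesis p1 : (1 < p)%N.
Implicit Types g : padicInt p.

Definition level_weights d i (w : 'I_d -> 'Z_(p ^ i.+1) -> X -> R) :=
  [/\ forall j c, continuous (w j c),
      forall j c e x, c != e -> w j c x * w j e x = 0,
      forall x, \sum_j \sum_c w j c x ^+ 2 = 1 &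
      forall j c g x, w j c (alpha g x) = w j (c - residue g i) x].

(** The weights of the sections are divided by the root of their sum of squares [S]. This sum is
    invariant, and positive because a nonzero value on a ray has a nonzero weight. *)
Lemma has_rays_weights d i : has_rays R alpha d i ->
  exists w : 'I_d -> 'Z_(p ^ i.+1) -> X -> R, level_weights w.
Proof.
move=> [z [s [zP sP s0]]].
have N1 := expS_gt1 p1 i.
pose nw (j : 'I_d) (c : 'Z_(p ^ i.+1)) x := near_weight z c (s j x).
pose S x := \sum_j \sum_c nw j c x ^+ 2.
have nw_cts j c : continuous (nw j c).
  by apply: near_weight_continuous; exact: Cfun_continuous.
have nw_equiv j c g x : nw j c (alpha g x) = nw j (c - residue g i) x.
  by rewrite /nw (sP j).1 -{1}(subrK (residue g i) c) (near_weight_rot N1 zP).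
have S_ge0 x : 0 <= S x.
  by apply: sumr_ge0 => j _; apply: sumr_ge0 => c _; exact: sqr_ge0.
have S_neq0 x : S x != 0.
  have [j jd sj] := s0 x.
  have [c nc] := near_weight_ray N1 zP ((sP j).2 x) sj.
  rewrite gt_eqF// /S (bigD1 (Ordinal jd))//= (bigD1 c)//= -addrA.
  rewrite ltr_pwDl ?exprn_even_gt0//= addr_ge0// sumr_ge0// => [e _|k _].
    exact: sqr_ge0.
  by apply: sumr_ge0 => e _; exact: sqr_ge0.
have S_equiv g x : S (alpha g x) = S x.
  apply: eq_bigr => j _; rewrite (reindex_inj (addIr (residue g i))) /=.
  by apply: eq_bigr => c _; rewrite nw_equiv addrK.
have S_cts : continuous S.
  move=> x; apply: cvg_big => [|j _]; first exact: add_continuous.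
  apply: cvg_big => [|c _]; first exact: add_continuous.
  by apply: cvgM; exact: nw_cts.
exists (fun j c x => nw j c x / Num.sqrt (S x)); split.
- move=> j c x; apply: cvgM; first exact: nw_cts.
  apply: cvgV; first by rewrite sqrtr_eq0 -ltNge lt_def S_neq0 S_ge0.
  by apply: (@continuous_comp _ _ _ S); [exact: S_cts|exact: sqrt_continuous].
- by move=> j c e x ce; rewrite mulrACA near_weight_ortho// mul0r.
- move=> x; under eq_bigr do under eq_bigr do
    rewrite expr_div_n sqr_sqrtr ?S_ge0//.
  under eq_bigr do rewrite -mulr_suml.
  by rewrite -mulr_suml -/(S x) divff.
- by move=> j c g x; rewrite nw_equiv S_equiv.
Qed.

Lemma has_rays_rokhlin d : (forall i, has_rays R alpha d.+1 i) ->
  rokhlin_maps (induced_action R alpha) d.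
Proof.
move=> h.
pose w i := projT1 (cid (has_rays_weights (h i))).
have wP i : level_weights (w i) := projT2 (cid (has_rays_weights (h i))).
pose v (j : 'I_d.+1) n c x := w n j c x.
have v_cts j n c : continuous (v j n c) by case: (wP n) => + _ _ _; apply.
have v_ortho j n c e x : c != e -> v j n c x * v j n e x = 0.
  by case: (wP n) => _ + _ _; apply.
have v_sum n x : \sum_j \sum_c v j n c x ^+ 2 = 1 by case: (wP n) => _ _ + _; apply.
have v_equiv j n c g x : v j n c (alpha g x) = v j n (c - residue g n) x.
  by case: (wP n) => _ _ _; apply.
have v_le1 j n x : \sum_c v j n c x ^+ 2 <= 1.
  rewrite -(v_sum n x) [leRHS](bigD1 j)//= lerDl sumr_ge0// => k _.
  by apply: sumr_ge0 => c _; exact: sqr_ge0.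
exists (fun j => limit_map (v_cts j) (v_le1 j)); split=> [j|j|].
- by apply: limit_map_cpc_order_zero => n c e x; exact: v_ortho.
- by apply: limit_map_equivariant => // n c g x; exact: v_equiv.
apply: val_inj.
rewrite (big_morph val (fun _ _ => erefl) (erefl : val (0 : commutant (Cfun R X)) = 0)).
rewrite -(big_morph (@pi_ainf R (Cfun R X)) (@pi_ainfD R (Cfun R X))
  (@pi_ainf0 R (Cfun R X))).
change (pi_ainf (\sum_j level_seq (v_cts j) (v_le1 j) 1) = pi_ainf 1).
congr pi_ainf; apply: linfP => n.
rewrite (big_morph (fun u : linf (Cfun R X) => u n) (fun _ _ => erefl)
  (erefl : (0 : linf (Cfun R X)) n = 0)).
apply: CfunP => x.
transitivity (\sum_j Cfun_fun (level_map (v_cts j) n 1) x).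
  by apply: (big_morph (fun f : Cfun R X => Cfun_fun f x)).
transitivity (\sum_j \sum_c (v j n c x ^+ 2)%:C).
  by apply: eq_bigr => j _; apply: eq_bigr => c _; exact: mul1r.
by under eq_bigr do rewrite -rmorph_sum; rewrite -rmorph_sum v_sum.
Qed.

End RaysToRokhlin.

(** * Uniform approximate invariance *)

Section Uniformity.
Variables (R : realType) (p : nat).
Hypothesis p1 : (1 < p)%N.
Variables (Phi : nat -> padicInt p -> R) (i : nat).
Hypothesis PhiB : forall k x y, Phi k (x - y) <= Phi k x + Phi k y.
Hypothesis Phi_cts0 : forall k e, 0 < e ->
  exists j, forall h, residue h j = 0 -> Phi k h < e.
Hypothesis Phi_cvg0 : forall h, residue h i = 0 ->
  forall e, 0 < e -> exists K, forall k, (K <= k)%N -> Phi k h < e.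

(* A Baire category argument: otherwise nested balls produce a point of the
   subgroup at which the convergence fails. *)
Lemma padic_uniform_ball d : 0 < d -> exists a j K,
  [/\ residue a i = 0, (i <= j)%N & forall b, residue b j = residue a j ->
      forall k, (K <= k)%N -> Phi k b <= d].
Proof.
move=> d0; apply/not_existsP => no.
(* A pair is a centre with a level. From one ball, pass to a smaller ball inside it on which [Phi k]
   exceeds [d] for some k >= n. *)
pose good n (aj bj : padicInt p * nat) := residue aj.1 i = 0 -> (i <= aj.2)%N ->
  [/\ residue bj.1 aj.2 = residue aj.1 aj.2, (aj.2 < bj.2)%N &
   exists2 k, (n <= k)%N &
     forall b, residue b bj.2 = residue bj.1 bj.2 -> d < Phi k b].
have /choice[f fP] (naj : nat * (padicInt p * nat)) :
    exists bj, good naj.1 naj.2 bj.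
  case: naj => n [a j]; rewrite /good /=.
  have [[ai ij]|aij] := pselect (residue a i = 0 /\ (i <= j)%N); last first.
    by exists (a, j) => ai ij; case: aij.
  have [b [bj [k nk dk]]] : exists b, residue b j = residue a j /\
      exists2 k, (n <= k)%N & d < Phi k b.
    apply: contrapT => nob; apply: (no a); exists j, n; split=> // b bj k nk.
    by rewrite leNgt; apply/negP => dk; apply: nob; exists b; split=> //; exists k.
  (* [Phi k b <= Phi k c + Phi k (c - b)], so the excess over [d] at [b] persists at every [c] near
     [b]. *)
  have [|j' hj'] := @Phi_cts0 k (Phi k b - d); first by rewrite subr_gt0.
  exists (b, maxn j' j.+1) => _ _ /=; split=> //; first exact: leq_maxr.
  exists k => // c cb; have := PhiB k c (c - b); rewrite subKr.
  have := hj' (c - b); rewrite residueB.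
  rewrite (residue_eq_le p1 (leq_maxl j' j.+1) cb) subrr => /(_ erefl).
  by lra.
pose s := fix s n := if n is n'.+1 then f (n', s n') else (0 : padicInt p, i).
have sinv n : residue (s n).1 i = 0 /\ (i + n <= (s n).2)%N.
  elim: n => [|n [IH1 IH2]]; first by rewrite addn0.
  have ij := leq_trans (leq_addr n i) IH2.
  have [/(residue_eq_le p1 ij) -> lt _] := fP (n, s n) IH1 ij.
  by split=> //; rewrite addnS; exact: leq_ltn_trans lt.
have ij n : (i <= (s n).2)%N := leq_trans (leq_addr n i) (sinv n).2.
have nj n : (n <= (s n).2)%N := leq_trans (leq_addl i n) (sinv n).2.
have sS n := fP (n, s n) (sinv n).1 (ij n).
have compat n m : residue (s (n + m)%N).1 (s n).2 = residue (s n).1 (s n).2.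
  elim: m => [|m IH]; first by rewrite addn0.
  rewrite addnS -IH; case: (sS (n + m)%N) => /= h _ _.
  apply: residue_eq_le h => //.
  elim: m {IH} => [|m IHm]; first by rewrite addn0.
  by rewrite addnS; case: (sS (n + m)%N) => /= _ /ltnW h _; exact: leq_trans IHm h.
(* Ball [t] has level at least [t], so it already fixes residue [t], and the centres define a p-adic
   integer. *)
have lS t : inZp (residue (s t.+1).1 t.+1) = residue (s t).1 t :> 'Z_(p ^ t.+1).
  by rewrite residueS; apply: residue_eq_le (nj t) _ => //; have := compat t 1%N; rewrite addn1.
pose l := PadicInt lS.
have lE n : residue l (s n).2 = residue (s n).1 (s n).2.
  by have := compat n ((s n).2 - n)%N; rewrite subnKC.
have li : residue l i = 0 by have := lE 0%N.
have [K hK] := Phi_cvg0 li d0.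
have [_ _ [k Kk /(_ l (lE K.+1))]] := sS K.
by rewrite ltNge ltW// hK.
Qed.

(** Points near 0 are differences of two points of the ball around [a], which costs 2e/3. Finitely
    many translates of this neighbourhood of 0 cover the subgroup, and pointwise convergence at
    their centres costs the last e/3. *)
Lemma padic_uniform e : 0 < e -> exists K, forall k, (K <= k)%N ->
  forall h, residue h i = 0 -> Phi k h < e.
Proof.
move=> e0; have d0 : 0 < e / 3 by rewrite divr_gt0.
have [a [j [K [ai ij aK]]]] := padic_uniform_ball d0.
have [L hL] : exists L, forall k, (L <= k)%N -> forall c : 'Z_(p ^ j.+1),
    residue (padic_nat p c) i = 0 -> Phi k (padic_nat p c) < e / 3.
  have [L _ hL] : \forall k \near \oo, forall c : 'Z_(p ^ j.+1),
      residue (padic_nat p c) i = 0 -> Phi k (padic_nat p c) < e / 3.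
    apply: filter_forall => c.
    have [ci|ci] := eqVneq (residue (padic_nat p c) i) 0; last first.
      by apply: nearW => k h; rewrite h eqxx in ci.
    by have [L hL] := Phi_cvg0 ci d0; exists L => // k Lk _; exact: hL.
  by exists L => k /hL.
exists (maxn K L) => k; rewrite geq_max => /andP[Kk Lk] h hi.
pose r := padic_nat p (residue h j).
have rj : residue r j = residue h j by exact: residue_padic_nat.
have ri : residue r i = 0 by rewrite (residue_eq_le p1 ij rj).
have small y : residue y j = 0 -> Phi k y <= e / 3 + e / 3.
  move=> y0; have := PhiB k (a + y) a; rewrite addrAC subrr add0r => /le_trans; apply.
  by rewrite lerD// aK// residueD y0 addr0.
have := PhiB k r (r - h); rewrite subKr.
have := small (r - h); rewrite residueB rj subrr => /(_ erefl).
have := hL k Lk _ ri; lra.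
Qed.

End Uniformity.

(** Compactness of [G] makes joint continuity uniform along orbits, so that infima over cosets stay
    continuous. *)
Lemma near_orbit (R : realType) (G : compactZmodType) (X : topologicalType)
    (alpha : space_action G X) (u : Cfun R X) x (e : R) : 0 < e -> \forall y \near x,
  forall k, normc (u (alpha (- k) y) - u (alpha (- k) x)) < e.
Proof.
move=> e0; have e2 : 0 < e / 2 by rewrite divr_gt0.
suff : \forall y \near x, forall k, [set: G] k ->
    normc (u (alpha (- k) y) - u (alpha (- k) x)) < e.
  by apply: filterS => y hy k; exact: hy.
have /compact_near_coveringP := @compactT (G); apply => k _.
have c : {for (k, x), continuous (fun kx : G * X => u (alpha (- kx.1) kx.2))}.
  apply: (@continuous_comp _ _ _ (fun kx : G * X => alpha (- kx.1) kx.2) u).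
    apply: (@continuous_comp _ _ _ (fun kx : G * X => (- kx.1, kx.2))
      (fun kx => alpha kx.1 kx.2)); last exact: sact_continuous.
    have c1 : {for (k, x), continuous (fun kx : G * X => - kx.1)}.
      apply: (@continuous_comp (G * X)%type G G fst -%R).
        exact: cvg_fst.
      exact: opp_continuous.
    by apply: cvg_pair; [exact: c1|exact: cvg_snd].
  exact: Cfun_continuous.
have /(_ (nbhs_filter (k, x)) _ e2) := (cvgcP _ _ _).1 c.
case=> -[U V] /= [Uk Vx] UV; exists (U, V) => // -[h y] /= [Uh Vy].
have h1 := UV (h, y) (conj Uh Vy).
have h2 := UV (h, x) (conj Uh (nbhs_singleton Vx)).
rewrite /= in h1 h2; set a := u (alpha (- k) x) in h1 h2.
rewrite -(subrK a (u (alpha (- h) y))) -addrA.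
rewrite (le_lt_trans (le_normcD _ _))// [ltRHS]splitr ltrD//.
by rewrite -normcN opprB.
Qed.

(** * Exact equivariance through infima over cosets *)

Section InfimumOverCoset.
Variables (R : realType) (p : nat) (X : topologicalType).
Variable alpha : space_action (padicInt p) X.
Hypothesis p1 : (1 < p)%N.
Variables (i : nat) (u : Cfun R X).
Implicit Types (g k : padicInt p) (c : 'Z_(p ^ i.+1)) (x y : X).

Definition coset_inf c x : R :=
  inf [set normc (u (alpha (- k) x)) | k in [set k | residue k i = c]].

Lemma coset_inf_le c x k :
  residue k i = c -> coset_inf c x <= normc (u (alpha (- k) x)).
Proof.
move=> kc; apply: ge_inf; last by exists k.
by exists 0 => _ [h _ <-]; exact: normc_ge0.
Qed.

Lemma coset_inf_ge c x m :
  (forall k, residue k i = c -> m <= normc (u (alpha (- k) x))) ->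
  m <= coset_inf c x.
Proof.
move=> h; apply: lb_le_inf; last by move=> _ [k kc <-]; exact: h.
exists (normc (u (alpha (- padic_nat p c) x))), (padic_nat p c) => //.
exact: residue_padic_nat.
Qed.

Lemma coset_inf_shift c g x :
  coset_inf (c + residue g i) (alpha g x) = coset_inf c x.
Proof.
apply/eqP; rewrite eq_le; apply/andP; split; apply: coset_inf_ge => k kc.
  have -> : alpha (- k) x = alpha (- (k + g)) (alpha g x).
    by rewrite -sactA opprD subrK.
  by apply: coset_inf_le; rewrite residueD kc.
rewrite -sactA (_ : - k + g = - (k - g)); last by rewrite opprB addrC.
by apply: coset_inf_le; rewrite residueB kc addrK.
Qed.

Lemma coset_inf_continuous c : continuous (coset_inf c).
Proof.
move=> x; apply/cvgrPdist_le => e e0.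
have := near_orbit alpha u x e0; apply: filterS => y hy.
have h k : normc (u (alpha (- k) y)) <= normc (u (alpha (- k) x)) + e /\
    normc (u (alpha (- k) x)) <= normc (u (alpha (- k) y)) + e.
  set a := u (alpha (- k) x); set b := u (alpha (- k) y).
  have ab : normc (b - a) < e by exact: hy.
  have := le_normcD (b - a) a; have := le_normcD (a - b) b.
  rewrite !subrK -(normcN (a - b)) opprB; lra.
rewrite ler_distl; apply/andP; split.
  apply: coset_inf_ge => k kc.
  by rewrite lerBlDr (le_trans (coset_inf_le y kc)) ?(h k).1.
rewrite -lerBlDr; apply: coset_inf_ge => k kc.
by rewrite lerBlDr (le_trans (coset_inf_le x kc)) ?(h k).2.
Qed.

End InfimumOverCoset.

(** * From Rokhlin maps to ray sections *)

Section RokhlinToRays.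
Variables (R : realType) (p : nat).
Hypothesis p1 : (1 < p)%N.

(** The infima are truncated at [d]. Two positive truncations would make a product exceed
    [d ^+ 2 >= e], whence orthogonality. Moving within a coset changes [u j] by at most [e], and
    [m - e > d] keeps some truncation positive at every point. *)
Lemma has_rays_of_approximate (X : topologicalType)
    (alpha : space_action (padicInt p) X) D i (u : 'I_D -> Cfun R X) (e d m : R) :
  0 < d -> e <= d ^+ 2 -> d + e < m ->
  (forall j h x, residue h i = 0 -> normc (u j (alpha (- h) x) - u j x) <= e) ->
  (forall j (c : 'Z_(p ^ i.+1)) x, c != 0 ->
     normc (u j x * u j (alpha (- padic_nat p c) x)) <= e) ->
  (forall x, exists j (c : 'Z_(p ^ i.+1)),
     m <= normc (u j (alpha (- padic_nat p c) x))) ->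
  has_rays R alpha D i.
Proof.
move=> d0 ed dem u_inv u_ortho u_cover.
have N1 := expS_gt1 p1 i.
have [z zP] := exists_prim_root R[i] (ltnW N1).
pose f j (c : 'Z_(p ^ i.+1)) x := Num.max 0 (coset_inf alpha (u j) c x - d).
have f_ge0 j c x : 0 <= f j c x by rewrite le_max lexx.
have f_gt j c x : f j c x != 0 ->
    forall k, residue k i = c -> d < normc (u j (alpha (- k) x)).
  move=> fj k kc; apply: lt_le_trans (coset_inf_le alpha (u j) x kc).
  rewrite ltNge; apply: contra fj => fd; apply/eqP/max_idPl.
  by rewrite subr_le0.
have f_ortho j c c' x : c != c' -> f j c x * f j c' x = 0.
  move=> cc'; apply/eqP; rewrite mulf_eq0; apply/norP => -[fc fc'].
  pose k := padic_nat p c; pose l := padic_nat p (c' - c)%R.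
  have kc : residue k i = c by exact: residue_padic_nat.
  have lc : residue (l + k) i = c' by rewrite residueD kc residue_padic_nat subrK.
  have := u_ortho j (c' - c) (alpha (- k) x); rewrite subr_eq0 eq_sym => /(_ cc').
  rewrite -sactA -/l -opprD normcM; apply/negP; rewrite -ltNge.
  rewrite (le_lt_trans ed)// expr2 ltr_pM ?ltW//; first exact: f_gt fc _ kc.
  exact: f_gt fc' _ lc.
have f_shift j c g x : f j (c + residue g i) (alpha g x) = f j c x.
  by rewrite /f coset_inf_shift.
have f_cts j c : continuous (f j c).
  apply: max0_continuous => x; apply: cvgB; last exact: cvg_cst.
  exact: coset_inf_continuous.
pose s (j : 'I_D) : Cfun R X := mkCfun (@ray_sum_continuous R X _ z (f j) (f_cts j)).
have sE j x : s j x = \sum_c (f j c x)%:C * z ^+ c by [].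
have sP j : ray_section alpha i z (s j).
  split=> [g x|x]; rewrite !sE; last first.
    by apply: (ray_sumP N1 zP _ _).1 => [c|c c']; [exact: f_ge0|exact: f_ortho].
  rewrite (reindex_inj (addIr (residue g i))) mulr_sumr; apply: eq_bigr => c _.
  by rewrite f_shift (prim_expZD N1 zP); ring.
exists z, (fun j => if insub j is Some o then s o else 0); split=> // [j|x].
  have zE y : Cfun_fun (0 : Cfun R X) y = 0 by [].
  case: insub => [k| ]; first exact: sP.
  split=> [g x|x]; rewrite !zE ?mulr0// exprn_ge0//.
have [j [c jc]] := u_cover x; exists (j : nat); rewrite ?valK//.
apply/eqP => sj0.
have := (ray_sumP N1 zP (fun c => f_ge0 j c x) (fun c c' => @f_ortho j c c' x)).2 sj0 c.
apply/eqP; rewrite gt_eqF// lt_max; apply/orP; right; rewrite subr_gt0.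
apply: (@lt_le_trans _ _ (m - e)); first by rewrite ltrBrDr.
apply: coset_inf_ge => k kc.
have := u_inv j (k - padic_nat p c) (alpha (- padic_nat p c) x).
rewrite residueB kc residue_padic_nat subrr => /(_ erefl).
rewrite -sactA opprB addrAC subrr sub0r.
set a := u j _; set b := u j _ => ab.
have := le_normcD (b - a) a; rewrite subrK -[normc (b - a)]normcN opprB.
by move: jc; rewrite -/b; lra.
Qed.

Variables (X : compactType) (alpha : space_action (padicInt p) X).
Notation A := (Cfun R X).
Notation delta := (induced_action R alpha).

Fact residue0_indicator_cts i :
  continuous (fun x : padicInt p => (residue x i == 0)%:R : R[i]).
Proof.
apply/continuous_normcP => x e e0; have := nbhs_residue x i.
by apply: filterS => y /= ->; rewrite subrr normc0.
Qed.

(** Its translates are the indicators of the cosets of p^(i+1) Z_p: orthogonal projections with sum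
    1, to which the Rokhlin maps are applied. *)
Definition residue0_indicator i : Cfun R (padicInt p) :=
  mkCfun (@residue0_indicator_cts i).

Local Notation lam := (induced_action R (translation (padicInt p))).

Lemma translate_indicatorE i g x :
  Cfun_fun (lam g (residue0_indicator i)) x = (residue x i == residue g i)%:R.
Proof.
have -> : Cfun_fun (lam g (residue0_indicator i)) x =
  (residue (- g + x) i == 0)%:R by [].
by rewrite residueD residueN addrC subr_eq0.
Qed.

Lemma translate_indicator_id i g : residue g i = 0 ->
  lam g (residue0_indicator i) = residue0_indicator i.
Proof. by move=> g0; apply: CfunP => x; rewrite [LHS]translate_indicatorE g0. Qed.

Lemma translate_indicator_ortho i g : residue g i != 0 ->
  residue0_indicator i * lam g (residue0_indicator i) = 0.
Proof.
move=> g0; apply: CfunP => x.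
transitivity ((residue x i == 0)%:R * Cfun_fun (lam g (residue0_indicator i)) x).
  by [].
rewrite translate_indicatorE; have [->|_] := eqVneq (residue x i) 0.
  by rewrite eq_sym (negbTE g0) mulr0.
by rewrite mul0r.
Qed.

Lemma sum_translate_indicator i :
  \sum_(c : 'Z_(p ^ i.+1)) lam (padic_nat p c) (residue0_indicator i) = 1.
Proof.
apply: CfunP => x.
transitivity (\sum_(c : 'Z_(p ^ i.+1))
    Cfun_fun (lam (padic_nat p c) (residue0_indicator i)) x).
  by apply: (big_morph (fun f : Cfun R (padicInt p) => Cfun_fun f x)).
rewrite (bigD1 (residue x i))// translate_indicatorE residue_padic_nat eqxx.
rewrite big1 => [|c cx]; first by rewrite [LHS]addr0.
by rewrite translate_indicatorE residue_padic_nat eq_sym (negbTE cx).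
Qed.

(** This supplies the hypothesis [PhiB] of the uniformity argument; it rests on the action being
    isometric. *)
Lemma sact_distB (u : A) g h :
  cnorm (delta (g - h) u - u) <= cnorm (delta g u - u) + cnorm (delta h u - u).
Proof.
rewrite -(act_cnorm delta h) -[- u]Defs.cscaleN1 act_add act_scale -actA !Defs.cscaleN1.
rewrite addrCA subrr addr0 (le_trans (cnorm_dist _ u _))//.
by rewrite (cnormB u).
Qed.

Lemma sact_small (u : A) e : 0 < e -> exists j, forall h : padicInt p,
  residue h j = 0 -> cnorm (delta h u - u) < e.
Proof.
move=> e0; have := act_continuous delta 0 u.
move=> /cvgrPdist_lt/(_ e e0)/(padic_continuous_ball p1)[j hj].
exists j => h hj0; have := hj h; rewrite hj0 => /(_ erefl).
by rewrite sub0r normrN ger0_norm ?cnorm_ge0// act0.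
Qed.

(** The images of the indicator are lifted to bounded sequences; equivariance, order zero and the
    sum condition become relations modulo null sequences. *)
Lemma rokhlin_sequences D i : rokhlin_maps delta D ->
  exists u : 'I_D.+1 -> linf A,
  [/\ forall j h, residue h i = 0 -> linf_act delta h (u j) - u j \in @c0_seq R A,
      forall j (c : 'Z_(p ^ i.+1)), c != 0 ->
        u j * linf_act delta (padic_nat p c) (u j) \in @c0_seq R A &
      \sum_j \sum_(c : 'Z_(p ^ i.+1)) linf_act delta (padic_nat p c) (u j) - 1
        \in @c0_seq R A].
Proof.
move=> [phi [phi_oz phi_equiv phi_sum]].
pose e0 := residue0_indicator i.
pose a j : ainf A := phi j e0.
have aE j g : pi_ainf (linf_act delta g (repr (a j))) = phi j (lam g e0) :> ainf A.
  by rewrite (phi_equiv j g e0).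
exists (fun j => repr (a j)); split=> [j h hi|j c c0|].
- apply/pi_ainfP; rewrite aE translate_indicator_id//.
  by symmetry; exact: reprK.
- rewrite -[_ * _]subr0; apply/pi_ainfP; rewrite pi_ainfM aE.
  have -> : pi_ainf (repr (a j)) = a j by exact: reprK.
  have [_ _ _ oz] := phi_oz j.
  have := oz _ _ (translate_indicator_ortho (i := i) (g := padic_nat p c) _).
  by rewrite residue_padic_nat => /(_ c0)/(congr1 val).
apply/pi_ainfP.
pose piD := big_morph (@pi_ainf R A) (@pi_ainfD R A) (@pi_ainf0 R A).
rewrite piD.
under eq_bigr do rewrite piD.
under eq_bigr do under eq_bigr do rewrite aE.
have -> : pi_ainf 1 = val (1 : commutant A) by [].
rewrite -phi_sum.
rewrite (big_morph val (fun _ _ => erefl) (erefl : val (0 : commutant A) = 0)).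
apply: eq_bigr => j _.
have [[phiD _] _ _ _] := phi_oz j.
have phi0 : phi j 0 = 0 by apply: (@addrI _ (phi j 0)); rewrite -phiD !addr0.
rewrite -(sum_translate_indicator i) (big_morph (phi j) phiD phi0).
by rewrite (big_morph val (fun _ _ => erefl) (erefl : val (0 : commutant A) = 0)).
Qed.

Lemma near_c0 (v : linf A) e : v \in @c0_seq R A -> 0 < e ->
  \forall k \near \oo, cnorm (v k) < e.
Proof. by move=> /c0_seqP h /h[N hN]; exists N. Qed.

Lemma rokhlin_has_rays D i : rokhlin_maps delta D -> has_rays R alpha D.+1 i.
Proof.
move=> /(rokhlin_sequences i)[u [u_inv u_ortho u_sum]].
pose L : R := (#|'I_D.+1| * #|'Z_(p ^ i.+1)|)%:R.
(* If all [L] values at a point were below 2d, their sum would have modulus at most 2dL < 1/2, yet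
   it lies within 1/2 of 1. *)
pose d : R := (4 * (L + 1))^-1.
have L0 : 0 <= L by exact: ler0n.
have d0 : 0 < d by rewrite invr_gt0; lra.
have dL : 4 * d * (L + 1) = 1.
  by rewrite mulrAC mulfV// gt_eqF//; lra.
have d4 : d <= 4^-1 by rewrite lef_pV2 ?posrE; lra.
have e0 : 0 < d ^+ 2 by exact: exprn_gt0.
have inv_near : \forall k \near \oo, forall j h, residue h i = 0 ->
    cnorm (delta h (u j k) - u j k) < d ^+ 2.
  apply: filter_forall => j.
  (* Invariance modulo null sequences is convergence for each fixed [h]; a single index [k] requires
     uniformity in [h]. *)
  have [||h hi r r0|K hK] := @padic_uniform R p p1
      (fun k h => cnorm (delta h (u j k) - u j k)) i _ _ _ _ e0.
  - by move=> k x y; exact: sact_distB.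
  - by move=> k r; exact: sact_small.
  - by have /c0_seqP/(_ r r0) := u_inv j h hi.
  - by exists K.
have ortho_near : \forall k \near \oo, forall j (c : 'Z_(p ^ i.+1)), c != 0 ->
    cnorm ((u j * linf_act delta (padic_nat p c) (u j)) k) < d ^+ 2.
  apply: filter_forall => j; apply: filter_forall => c.
  have [->|c0] := eqVneq c 0; first by apply: nearW => k /eqP.
  by have := near_c0 (u_ortho j c c0) e0; apply: filterS.
have sum_near := near_c0 u_sum (ltac:(lra) : 0 < 2^-1 :> R).
have [k [[k_inv k_ortho] k_sum]] :=
  filter_ex (filterI (filterI inv_near ortho_near) sum_near).
apply: (@has_rays_of_approximate X alpha _ i (fun j => u j k) (d ^+ 2) d (2 * d)) => //.
- by rewrite mulrDl mul1r ltrD2l expr2 -[ltRHS]mul1r ltr_pM2r//; lra.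
- move=> j h x hi; apply/ltW/(le_lt_trans _ (k_inv j h hi)).
  exact: normc_le_Cfun_cnorm (delta h (u j k) - u j k) x.
- move=> j c x c0; apply/ltW/(le_lt_trans _ (k_ortho j c c0)).
  exact: normc_le_Cfun_cnorm ((u j * linf_act delta (padic_nat p c) (u j)) k) x.
move=> x; apply: contrapT => no.
pose S : R[i] := \sum_j \sum_(c : 'Z_(p ^ i.+1)) u j k (alpha (- padic_nat p c) x).
have S1 : normc (S - 1) < 2^-1.
  apply: le_lt_trans k_sum; set v := cnorm _.
  have -> : S - 1 = Cfun_fun ((\sum_j \sum_(c : 'Z_(p ^ i.+1))
      linf_act delta (padic_nat p c) (u j) - 1) k) x.
    rewrite /S linfB [RHS]Cfun_subE; congr (_ - _).
    rewrite (big_morph (fun u : linf A => Cfun_fun (u k) x) (fun _ _ => erefl)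
      (erefl : Cfun_fun ((0 : linf A) k) x = 0)).
    apply: eq_bigr => j _.
    by rewrite (big_morph (fun u : linf A => Cfun_fun (u k) x) (fun _ _ => erefl)
      (erefl : Cfun_fun ((0 : linf A) k) x = 0)).
  exact: normc_le_Cfun_cnorm.
have S2 : normc S <= L * (2 * d).
  apply: le_trans (normc_sum _) _.
  have -> : L * (2 * d) = \sum_(j < D.+1) \sum_(c : 'Z_(p ^ i.+1)) (2 * d).
    by rewrite !sumr_const -mulrnA -(mulr_natl (2 * d)) mulnC.
  apply: ler_sum => j _; apply: le_trans (normc_sum _) _.
  apply: ler_sum => c _; rewrite leNgt; apply/negP => lt; apply: no.
  by exists j, c; exact: ltW.
have := le_normcD (- (S - 1)) S.
rewrite normcN opprB subrK normc1; nra.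
Qed.

End RokhlinToRays.

(** * Finite Rokhlin dimension and the bound 3 *)

Lemma dimRok_ltyP (R : realType) (G : compactZmodType) (A : cstarAlgType R)
    (delta : cstar_action G A) :
  (dimRok delta < +oo)%E -> exists n, rokhlin_maps delta n.
Proof.
rewrite /dimRok; case: pselect => [[n /asboolP nP] _|_]; first by exists n.
by rewrite ltxx.
Qed.

Lemma dimRok_le (R : realType) (G : compactZmodType) (A : cstarAlgType R)
    (delta : cstar_action G A) n :
  rokhlin_maps delta n -> (dimRok delta <= n%:R%:E)%E.
Proof.
move=> nP; rewrite /dimRok; case: pselect => [ex|[]]; last by exists n; exact/asboolP.
by rewrite lee_fin ler_nat; case: ex_minnP => m _; apply; exact/asboolP.
Qed.

Unset Implicit Arguments.

Local Open Scope ring_scope.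
Local Open Scope ereal_scope.

Theorem theorem5p17 (R : realType) (p : nat) (hp : prime p)
    (X : compactMetricType R) (alpha : space_action (padicInt p) X) :
  dimRok (induced_action R alpha) < +oo ->
  dimRok (induced_action R alpha) <= 3%:R%:E.
Proof.
have p1 := prime_gt1 hp.
(* Dimension n counts n + 1 maps, so the bound 3 corresponds to 4 ray coordinates. *)
move=> /dimRok_ltyP[D rok]; apply/dimRok_le/(has_rays_rokhlin p1).
by apply: (has_rays4 p1) => i; exact: rokhlin_has_rays rok.
Qed.
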